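(* Let $\boldsymbol X_1,\boldsymbol X_2,\dots$ be i.i.d. random vectors in $(0,\infty)^d$ with density $f_0=f_{G_0}\in\mathcal F_{SMU}(d)$, defined as the coordinates on the completed infinite product space with probability $P^\infty$. For each $n$ let $\widehat f_n=f_{\widehat G_n}\in\mathcal F_{SMU}(d)$ be the ($P^\infty$-almost surely unique) maximum likelihood estimator based on $\boldsymbol X_1,\dots,\boldsymbol X_n$, with mixing distribution $\widehat G_n$. Then: (a)(i) $\widehat G_n$ converges weakly to $G_0$ as $n\to\infty$, $P^\infty$-almost surely. (a)(ii) For Lebesgue almost all $\boldsymbol x\in(0,\infty)^d$, $\widehat f_n(\boldsymbol x)\to f_0(\boldsymbol x)$ $P^\infty$-almost surely as $n\to\infty$. In particular, if $f_0$ is continuous at $\boldsymbol x\in(0,\infty)^d$, then $|\widehat f_n(\boldsymbol x)-f_0(\boldsymbol x)|\to0$ $P^\infty$-almost surely as $n\to\infty$. (b) The sequence $\{\widehat f_n\}$ is strongly consistent in the total variation ($L_1$) and Hellinger metrics: as $n\to\infty$, $P^\infty$-almost surely, $$\int_{(0,\infty)^d}|\widehat f_n(\boldsymbol x)-f_0(\boldsymbol x)|\,d\boldsymbol x\to0\qquad\text{and}\qquad h(\widehat f_n,f_0)\to0 .$$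
   Context: For $\boldsymbol v\in(0,\infty)^d$ write $|\boldsymbol v|=\prod_{i=1}^d v_i$ and $(\boldsymbol 0,\boldsymbol v]=\prod_i(0,v_i]$. $\mathcal G_d$ is the set of all distribution functions of probability measures on $(0,\infty)^d$. For $G\in\mathcal G_d$, $$f_G(\boldsymbol x)=\int_{(0,\infty)^d}\frac1{|\boldsymbol v|}\mathbf 1_{(\boldsymbol 0,\boldsymbol v]}(\boldsymbol x)\,dG(\boldsymbol v),\quad \boldsymbol x\in(0,\infty)^d,\qquad \mathcal F_{SMU}(d)=\{f_G:G\in\mathcal G_d\};$$ $G$ is uniquely determined by $f_G$ and is called its mixing distribution. A maximum likelihood estimator based on $\boldsymbol X_1,\dots,\boldsymbol X_n$ is an element of $\mathcal F_{SMU}(d)$ maximizing $f\mapsto\prod_{i=1}^nf(\boldsymbol X_i)$ over $\mathcal F_{SMU}(d)$; for each $n$ it exists and is unique with probability one. The Hellinger distance is $h^2(p,q)=\frac12\int\{\sqrt{p(\boldsymbol x)}-\sqrt{q(\boldsymbol x)}\}^2d\boldsymbol x$. *)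

(* Defs.v *)
From HB Require Import structures.
From mathcomp Require Import all_boot all_order all_algebra.
From mathcomp Require Import all_classical all_reals all_analysis.
From mathcomp Require Import measurable_realfun.
Set Implicit Arguments.
Unset Strict Implicit.
Unset Printing Implicit Defensive.
Import Order.TTheory GRing.Theory Num.Theory numFieldNormedType.Exports.

Local Open Scope classical_set_scope.
Local Open Scope ring_scope.

(* R^d is 'rV[R]_d with the Borel sigma-algebra of its usual topology. *)
HB.instance Definition _ (R : realType) (d : nat) :=
  @isMeasurable.Build (sigma_display (@open 'rV[R]_d)) 'rV[R]_d
    <<s @open 'rV[R]_d >> (@sigma_algebra0 _ setT _) (@sigma_algebraC _ _)
    (@sigma_algebra_bigcup _ setT _).

Section borel.
Context {R : realType}.

Lemma open_measurable_rV d (U : set 'rV[R]_d) : open U -> measurable U.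
Proof. exact: sub_sigma_algebra. Qed.

Lemma measurable_coord_rV d (i : 'I_d) :
  measurable_fun [set: 'rV[R]_d] (fun v => v ord0 i).
Proof.
apply: (measurability _ (RGenOpens.measurableE R)).
move=> _ [_ [a [b ->] <-]]; rewrite setTI; apply: open_measurable_rV.
apply: open_comp; last exact: interval_open.
move=> v _; exact: coord_continuous.
Qed.

Definition rat_box d (p : {ffun 'I_d -> rat * rat}) : set 'rV[R]_d :=
  [set v | forall i, v ord0 i \in `](ratr (p i).1), (ratr (p i).2)[].

Lemma open_rV_rat_box d (U : set 'rV[R]_d) : open U ->
  U = \bigcup_(p in [set p | rat_box p `<=` U]) rat_box p.
Proof.
move=> oU; apply/seteqP; split => [v Uv|v [p pU]]; last exact: pU.
have /nbhs_ballP[e /= e0 eU] : nbhs v U by exact: open_nbhs_nbhs.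
have q i : {q : rat * rat | v ord0 i - e < ratr q.1 < v ord0 i
                         /\ v ord0 i < ratr q.2 < v ord0 i + e}.
  apply: cid.
  have [|a] := @rat_in_itvoo R (v ord0 i - e) (v ord0 i).
    by rewrite ltrBlDr ltrDl.
  have [|b] := @rat_in_itvoo R (v ord0 i) (v ord0 i + e).
    by rewrite ltrDl.
  by rewrite !in_itv /= => hb ha; exists (a, b).
exists [ffun i => sval (q i)] => [w /= wq|i].
  apply: eU; split => // i j; rewrite (ord1 i) /ball /= ltr_norml.
  have := wq j; rewrite ffunE in_itv /= => /andP[].
  have [/andP[h1 h2] /andP[h3 h4] h5 h6] := svalP (q j).
  apply/andP; split.
  - by rewrite ltrBrDl ltrBlDr (lt_trans h6).
  - by rewrite ltrBlDl -ltrBlDr (lt_trans h1).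
rewrite ffunE in_itv /=.
by have [/andP[_ ->] /andP[-> _]] := svalP (q i).
Qed.

Lemma measurable_fun_rV d d0 (T : measurableType d0) (f : T -> 'rV[R]_d) :
  (forall i, measurable_fun setT (fun t => f t ord0 i)) ->
  measurable_fun setT f.
Proof.
move=> mf; apply: (@measurability _ _ _ _ _ _ (@open 'rV[R]_d)) => //.
move=> _ [U oU <-]; rewrite setTI (open_rV_rat_box oU) preimage_bigcup.
rewrite bigcup_mkcond; apply: countable_bigcupT_measurable => // p.
case: ifP => // _.
rewrite (_ : _ @^-1` _ = \big[setI/setT]_(i < d)
   ((fun t => f t ord0 i) @^-1` `](ratr (p i).1), (ratr (p i).2)[)).
  apply: bigsetI_measurable => i _; rewrite -[X in measurable X]setTI.
  exact: mf.
rewrite -bigcap_seq; apply/seteqP; split => t /= h i; first by move=> _; exact: h.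
by apply: h; rewrite /= mem_index_enum.
Qed.

Lemma measurable_box_rV d (I : 'I_d -> interval R) :
  measurable [set v : 'rV[R]_d | forall i, v ord0 i \in I i].
Proof.
rewrite (_ : [set v | _] = \big[setI/setT]_(i < d)
   ((fun v : 'rV[R]_d => v ord0 i) @^-1` [set` I i])).
  apply: bigsetI_measurable => i _; rewrite -[X in measurable X]setTI.
  by apply: measurable_coord_rV => //; exact: measurable_itv.
rewrite -bigcap_seq; apply/seteqP; split => t /= h i; first by move=> _; exact: h.
by apply: h; rewrite /= mem_index_enum.
Qed.

End borel.

Section lebesgue.
Context {R : realType}.

Definition cons_rV d (p : R * 'rV[R]_d) : 'rV[R]_d.+1 :=
  \row_i oapp (p.2 ord0) p.1 (unlift ord0 i).

Lemma measurable_cons_rV d : measurable_fun setT (@cons_rV d).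
Proof.
apply: measurable_fun_rV => i.
under eq_fun do rewrite mxE.
case: unliftP => [j _|_] /=; last exact: measurable_fst.
exact: (measurableT_comp (measurable_coord_rV j) measurable_snd).
Qed.

Definition lebesgue_cons d (m : {measure set 'rV[R]_d -> \bar R}) :=
  pushforward (lebesgue_measure \x^ m)%E (@cons_rV d).

Section lebesgue_cons_measure.
Variables (d : nat) (m : {measure set 'rV[R]_d -> \bar R}).

Let mcons A : measurable A -> measurable (@cons_rV d @^-1` A).
Proof.
by move=> mA; rewrite -[X in measurable X]setTI; exact: measurable_cons_rV.
Qed.

Let lebesgue_cons0 : lebesgue_cons m set0 = 0%E.
Proof. by rewrite /lebesgue_cons /pushforward preimage_set0 measure0. Qed.

Let lebesgue_cons_ge0 A : (0 <= lebesgue_cons m A)%E.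
Proof. by rewrite /lebesgue_cons /pushforward measure_ge0. Qed.

Let lebesgue_cons_sigma_additive : semi_sigma_additive (lebesgue_cons m).
Proof.
move=> F mF tF mUF; rewrite /lebesgue_cons /pushforward preimage_bigcup.
apply: measure_semi_sigma_additive => [n||].
- by apply: mcons; exact: mF.
- apply/trivIsetP => /= i j _ _ ij; rewrite -preimage_setI.
  by move/trivIsetP : tF => /(_ _ _ _ _ ij) ->//; rewrite preimage_set0.
- by rewrite -preimage_bigcup; exact: mcons.
Qed.

HB.instance Definition _ := isMeasure.Build _ _ _ (lebesgue_cons m)
  lebesgue_cons0 lebesgue_cons_ge0 lebesgue_cons_sigma_additive.

End lebesgue_cons_measure.

Fixpoint lebesgue_rV d : {measure set 'rV[R]_d -> \bar R} :=
  match d with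
  | 0 => \d_(0 : 'rV[R]_0)
  | d'.+1 => lebesgue_cons (lebesgue_rV d')
  end.

Lemma lebesgue_rV_box d (a b : 'I_d -> R) : (forall i, a i <= b i) ->
  lebesgue_rV d [set v | forall i, v ord0 i \in `]a i, b i]] =
  (\prod_(i < d) (b i - a i))%:E.
Proof.
elim: d a b => [|d IH] a b ab.
  by rewrite big_ord0 /= diracE mem_set//= => -[].
pose B := [set v : 'rV[R]_d | forall i,
  v ord0 i \in `]a (lift ord0 i), b (lift ord0 i)]].
rewrite big_ord_recl EFinM /= /lebesgue_cons /pushforward.
rewrite (_ : _ @^-1` _ = `]a ord0, b ord0] `*` B); last first.
  apply/seteqP; split => -[x v] /=.
    move=> h; split=> [|i]; last by have := h (lift ord0 i); rewrite mxE liftK.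
    by have := h ord0; rewrite mxE unlift_none.
  by move=> [h1 h2] i; rewrite mxE; case: unliftP => [j ->|->] /=.
rewrite product_measure2E; last 2 first.
- exact: measurable_itv.
- exact: measurable_box_rV.
have ab0 : lebesgue_measure `]a ord0, b ord0]%classic = (b ord0 - a ord0)%:E.
  rewrite lebesgue_measure_itv /= lte_fin; case: ltP => // ba.
  by rewrite (@le_anti _ _ (a ord0) (b ord0)) ?ab ?subrr.
by congr (_ * _)%E; [exact: ab0|exact: IH].
Qed.

End lebesgue.

Section scale_mixtures_of_uniforms.
Context {R : realType} {d : nat}.
Implicit Types (x v : 'rV[R]_d) (f g : 'rV[R]_d -> R).

Definition orthant : set 'rV[R]_d := [set v | forall i, 0 < v ord0 i].

Definition vol v : R := \prod_(i < d) v ord0 i.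

Definition box v : set 'rV[R]_d :=
  [set x | forall i, x ord0 i \in `]0, v ord0 i]].

(* A distribution function on (0,oo)^d is identified with the probability
   measure it determines. *)
Definition mixing : set (probability 'rV[R]_d R) :=
  [set G | G orthant = 1%E].

(* For x in the orthant the integrand is at most (vol x)^-1, so the integral is
   finite; off the orthant the integrand is 0. *)
Definition smu_density (G : probability 'rV[R]_d R) x : R :=
  \int[G]_(v in orthant) ((vol v)^-1 * \1_(box v) x).

Definition SMU : set ('rV[R]_d -> R) := [set smu_density G | G in mixing].

Definition is_MLE (n : nat) (X : nat -> 'rV[R]_d) f :=
  SMU f /\ forall g, SMU g -> \prod_(i < n) g (X i) <= \prod_(i < n) f (X i).

(* Weak convergence of probability measures on the space (0,oo)^d. *)
Definition weak_cvg (G_ : nat -> probability 'rV[R]_d R)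
    (G : probability 'rV[R]_d R) :=
  forall phi : 'rV[R]_d -> R, {within orthant, continuous phi} ->
    [bounded phi x | x in orthant] ->
    \int[G_ n]_(x in orthant) phi x @[n --> \oo] -->
    \int[G]_(x in orthant) phi x.

Definition L1_distance f g : \bar R :=
  (\int[lebesgue_rV d]_(x in orthant) `|f x - g x|%:E)%E.

Definition hellinger f g : \bar R :=
  (sqrte (2^-1%:E * \int[lebesgue_rV d]_(x in orthant)
    ((Num.sqrt (f x) - Num.sqrt (g x)) ^+ 2)%:E))%E.

End scale_mixtures_of_uniforms.

Section infinite_product.
Variables (R : realType) (d : nat).

Definition cylinders : set (set (nat -> 'rV[R]_d)) :=
  \bigcup_i preimage_set_system setT (fun w => w i) measurable.

Definition sample_space := g_sigma_algebraType cylinders.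

(* P is the law of an i.i.d. sequence with density f on (0,oo)^d: the values on
   finite-dimensional rectangles determine P.  Almost-sure statements
   {ae P, _} only require a complement contained in a measurable P-null set, so
   they are those of the completion of P. *)
Definition iid_law (P : probability sample_space R) (f : 'rV[R]_d -> R) :=
  forall (n : nat) (B : 'I_n -> set 'rV[R]_d),
    (forall i, measurable (B i)) ->
    P [set w | forall i : 'I_n, B i (w i)] =
    (\prod_(i < n) \int[lebesgue_rV d]_(x in orthant `&` B i) (f x)%:E)%E.

End infinite_product.

(* Main.v *)
Require Import Defs.
From HB Require Import structures.
From mathcomp Require Import all_boot all_order all_algebra.
From mathcomp Require Import all_classical all_reals all_analysis.
From mathcomp Require Import measurable_realfun ring lra.
Set Implicit Arguments.
Unset Strict Implicit.
Unset Printing Implicit Defensive.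
Import Order.TTheory GRing.Theory Num.Theory numFieldNormedType.Exports.

Local Open Scope classical_set_scope.
Local Open Scope ring_scope.

(** The maximum likelihood estimators converge in L1 on an explicit almost sure
event, and every other conclusion follows from that convergence.

The model is convex, so at its maximizer f the derivative of the log-likelihood
towards f0 is nonpositive, which says that the empirical mean of f0 / f is at
most 1 (MLE_score).  If the empirical measure could be replaced by the law of
the sample, the integral of f0 ^ 2 / f would be at most 1, while
f0 ^ 2 / f - 2 f0 + f = (f0 - f) ^ 2 / f has integral at most 0 in that case,
whence f = f0.

The replacement is made quantitative on a grid of boxes whose corners form
geometric progressions of ratio r.  Densities of the model decrease in every
coordinate, so on each cell f is at most its value q at the lower corner and f0
is at least its value p at the upper corner.  Since the upper corners of the
cells are the lower corners of shifted cells with volumes multiplied by r ^ d,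
the Riemann sums of p and q are within a factor r ^ d of integrals over shifted
grids, uniformly over the model and with no entropy computation.  With a lower
bound on the empirical frequencies of the cells, this yields an explicit bound
on the L1 distance between f and f0 (grid_bound).  The frequencies are bounded
from below by the lower half of the strong law of large numbers for indicators,
proved by Chernoff's bound and the Borel-Cantelli lemma (ae_count_in_ge); only
countably many cells are needed.  Letting the grid get finer and larger gives
L1 convergence (typical_L1_cvg, ae_typical).

Consequences.  The squared Hellinger distance is at most half of the L1
distance.  For a decreasing density the value at x lies between averages over
boxes on either side of x, and averages converge, so the densities converge at
each x where f0 is continuous (smu_density_pointwise_cvg); f0 is continuous at
x unless G0 charges a coordinate hyperplane through x, which by Tonelli's
theorem happens only for a null set of x (ae_no_atom).  For weak convergence,
the mass that the density of a mixing distribution G gives to the box (0, a] is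
the integral over G of the product of the functions min 1 (a_i / v_i).
Products of second differences of these functions form a partition of unity by
hat functions, so the integrals of arbitrarily fine approximations of a
continuous function from below converge, and the integrals of a bounded
continuous function converge as well (L1_weak_cvg). *)

(** * The orthant, boxes and Lebesgue measure *)

Section orthant_and_boxes.
Context {R : realType} {d : nat}.
Implicit Types (x v a b : 'rV[R]_d).

Definition rect a b : set 'rV[R]_d :=
  [set x | forall i, x ord0 i \in `]a ord0 i, b ord0 i]].

Lemma measurable_rect a b : measurable (rect a b).
Proof. exact: (@measurable_box_rV R d (fun i => `]a ord0 i, b ord0 i])). Qed.

Lemma box_rect v : box v = rect 0 v.
Proof.
by apply/seteqP; split => x /= h i; have := h i; rewrite ?mxE.
Qed.

Lemma measurable_box v : measurable (box v).
Proof. by rewrite box_rect; exact: measurable_rect. Qed.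

Lemma measurable_orthant : measurable (@orthant R d).
Proof.
rewrite (_ : orthant = [set v | forall i, v ord0 i \in `]0, +oo[]).
  exact: (@measurable_box_rV R d (fun i => `]0, +oo[)).
by apply/seteqP; split => x /= h i; have := h i; rewrite in_itv/= andbT.
Qed.

Lemma box_orthant v x : box v x -> orthant x.
Proof. by move=> h i; have := h i; rewrite in_itv/= => /andP[]. Qed.

Lemma vol_gt0 x : orthant x -> 0 < vol x.
Proof. by move=> ox; apply: prodr_gt0 => i _; exact: ox. Qed.

Lemma le_vol x v : orthant x -> (forall i, x ord0 i <= v ord0 i) ->
  vol x <= vol v.
Proof.
by move=> ox xv; apply: ler_prod => i _; rewrite xv andbT ltW//; exact: ox.
Qed.

Lemma measurable_vol : measurable_fun setT (@vol R d).
Proof. by apply: measurable_prod => i _; exact: measurable_coord_rV. Qed.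

(** A copy of Lebesgue measure that carries the sigma-finite structure, which
Tonelli's theorem asks of both of its measures. *)
Definition leb (A : set 'rV[R]_d) : \bar R := lebesgue_rV d A.

HB.instance Definition _ := Measure.on leb.

Lemma leb_rect a b : (forall i, a ord0 i <= b ord0 i) ->
  leb (rect a b) = (\prod_(i < d) (b ord0 i - a ord0 i))%:E.
Proof. exact: lebesgue_rV_box. Qed.

Lemma leb_sigma_finite : sigma_finite setT leb.
Proof.
exists (fun n => rect (const_mx (- n%:R)) (const_mx n%:R)).
  apply/esym/seteqP; split => // x _.
  pose M := \sum_(i < d) `|x ord0 i|.
  exists (Num.truncn M).+1 => // i; rewrite /= !mxE in_itv/=.
  have xM : `|x ord0 i| < (Num.truncn M).+1%:R.
    apply: le_lt_trans (truncnS_gt _).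
    by rewrite /M (bigD1 i)//= lerDl sumr_ge0.
  by move: xM; rewrite ltr_norml => /andP[-> /ltW ->].
move=> n; split; first exact: measurable_rect.
by rewrite leb_rect ?ltry// => i; rewrite !mxE ge0_cp// -subr_ge0 opprK addr_ge0.
Qed.

HB.instance Definition _ :=
  @Measure_isSigmaFinite.Build _ _ _ leb leb_sigma_finite.

End orthant_and_boxes.

(** * Densities of scale mixtures of uniforms *)

Section smu_density_theory.
Context {R : realType} {d : nat}.
Implicit Types (x y v a b : 'rV[R]_d) (G : probability 'rV[R]_d R).

(** The indicator of the orthant is put into the kernel so that all integrals
against a mixing distribution can be taken over the whole space. *)
Definition smu_kernel x v : R := \1_orthant v * ((vol v)^-1 * \1_(box v) x).

Lemma smu_kernelE x v : orthant v -> (forall i, 0 < x ord0 i <= v ord0 i) ->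
  smu_kernel x v = (vol v)^-1.
Proof.
move=> ov xv; rewrite /smu_kernel !indicE mem_set// mem_set ?mul1r ?mulr1//.
Qed.

Lemma smu_kernel_eq0 x v : ~ (forall i, 0 < x ord0 i <= v ord0 i) ->
  smu_kernel x v = 0.
Proof.
move=> xv; rewrite /smu_kernel !indicE (_ : x \in box v = false) ?mulr0//.
by apply/memNset => h; apply: xv => i; have := h i; rewrite in_itv.
Qed.

Lemma smu_kernel_ge0 x v : 0 <= smu_kernel x v.
Proof.
rewrite /smu_kernel; have [ov|ov] := pselect (orthant v); last first.
  by rewrite indicE memNset// mul0r.
by rewrite !mulr_ge0// invr_ge0 ltW// vol_gt0.
Qed.

(** If x lies in the box of corner v, then the volume of that box is at least
vol x.  This domination makes the density finite and licenses the dominated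
convergence used for its continuity points. *)
Lemma smu_kernel_le x v : orthant x -> smu_kernel x v <= (vol x)^-1.
Proof.
move=> ox; have x0 := vol_gt0 ox.
have [xv|xv] := pselect (forall i, 0 < x ord0 i <= v ord0 i); last first.
  by rewrite smu_kernel_eq0// invr_ge0 ltW.
have ov : orthant v by move=> i; have /andP[/lt_le_trans] := xv i; exact.
rewrite smu_kernelE// lef_pV2 ?posrE ?vol_gt0//.
by apply: le_vol => // i; have /andP[] := xv i.
Qed.

Lemma smu_kernel_anti x y v : orthant x ->
  (forall i, x ord0 i <= y ord0 i) -> smu_kernel y v <= smu_kernel x v.
Proof.
move=> ox xy; have [yv|yv] := pselect (forall i, 0 < y ord0 i <= v ord0 i).
  have ov : orthant v by move=> i; have /andP[/lt_le_trans] := yv i; exact.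
  rewrite !smu_kernelE// => i; rewrite ox/= (le_trans (xy i))//.
  by have /andP[] := yv i.
by rewrite (smu_kernel_eq0 yv) smu_kernel_ge0.
Qed.

Lemma measurable_smu_kernel :
  measurable_fun setT (fun p : 'rV[R]_d * 'rV[R]_d => smu_kernel p.1 p.2).
Proof.
have m1 i := measurableT_comp (@measurable_coord_rV R d i)
  (@measurable_fst _ _ 'rV[R]_d 'rV[R]_d).
have m2 i := measurableT_comp (@measurable_coord_rV R d i)
  (@measurable_snd _ _ 'rV[R]_d 'rV[R]_d).
rewrite (_ : (fun _ => _) = fun p => \1_orthant p.2 * ((vol p.2) `^ (-1) *
   \1_(\big[setI/setT]_(i < d)
     [set p : 'rV[R]_d * 'rV[R]_d | 0 < p.1 ord0 i <= p.2 ord0 i]) p)).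
  apply: measurable_funM.
    exact: (measurableT_comp (measurable_indic measurable_orthant)
      measurable_snd).
  apply: measurable_funM.
    apply: (measurableT_comp (measurable_powR (-1))).
    exact: (measurableT_comp measurable_vol measurable_snd).
  apply: measurable_indic; apply: bigsetI_measurable => i _.
  have mi : measurable_fun setT
      (fun p : 'rV[R]_d * 'rV[R]_d => 0 < p.1 ord0 i <= p.2 ord0 i).
    apply: measurable_and; last exact: (measurable_fun_ler (m1 i) (m2 i)).
    by apply: measurable_fun_ltr => //; exact: m1.
  rewrite -[X in measurable X]setTI.
  exact: (mi measurableT [set true]).
apply/funext => -[x v] /=.
rewrite /smu_kernel; have [ov|ov] := pselect (orthant v); last first.
  by rewrite indicE memNset// !mul0r.
rewrite powR_inv1 ?ltW ?vol_gt0//; congr (_ * (_ * _)).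
rewrite !indicE; congr (nat_of_bool _)%:R.
apply/idP/idP; rewrite !inE -bigcap_seq /=.
  by move=> h i _; have := h i; rewrite in_itv.
by move=> h i; rewrite in_itv; apply: h; rewrite /= mem_index_enum.
Qed.

Lemma measurable_smu_kernelr x : measurable_fun setT (smu_kernel x).
Proof. exact: (measurableT_comp measurable_smu_kernel (pair1_measurable x)). Qed.

Lemma smu_kernel_integrable G x : G.-integrable setT (EFin \o smu_kernel x).
Proof.
have [ox|ox] := pselect (orthant x); last first.
  rewrite (_ : _ \o _ = cst 0%E); first exact: integrable0.
  apply/funext => v /=; rewrite smu_kernel_eq0// => h; apply: ox => i.
  by have /andP[] := h i.
apply: (@le_integrable _ _ _ _ _ measurableT _ (cst (vol x)^-1%:E)) => //.
- by apply/measurable_EFinP; exact: measurable_smu_kernelr.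
- move=> v _ /=; rewrite lee_fin ger0_norm ?smu_kernel_ge0// ger0_norm.
    exact: smu_kernel_le.
  by rewrite invr_ge0 ltW// vol_gt0.
- by apply: finite_measure_integrable_cst.
Qed.

Lemma smu_densityE G x :
  (smu_density G x)%:E = (\int[G]_v (smu_kernel x v)%:E)%E.
Proof.
have /integrable_fin_num := smu_kernel_integrable G x => /(_ measurableT) fi.
rewrite -[RHS]fineK//; congr EFin.
rewrite /smu_density Rintegral_mkcond /Rintegral; congr fine.
apply: eq_integral => v _; congr EFin.
rewrite /smu_kernel patchE [\1_orthant v]indicE.
by case: ifPn => vo; rewrite ?mul1r ?mul0r.
Qed.

Lemma smu_density_ge0 G x : 0 <= smu_density G x.
Proof.
rewrite -lee_fin smu_densityE; apply: integral_ge0 => v _.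
by rewrite lee_fin smu_kernel_ge0.
Qed.

Lemma smu_density_eq0 G x : ~ orthant x -> smu_density G x = 0.
Proof.
move=> ox; apply: EFin_inj; rewrite smu_densityE integral0_eq// => v _.
rewrite smu_kernel_eq0// => h; apply: ox => i.
by have /andP[] := h i.
Qed.

Lemma measurable_smu_density G : measurable_fun setT (smu_density G).
Proof.
apply/measurable_EFinP.
rewrite (_ : _ \o _ = fubini_F G
  (fun p : 'rV[R]_d * 'rV[R]_d => (smu_kernel p.1 p.2)%:E)).
  apply: measurable_fun_fubini_tonelli_F => [|p].
    by apply/measurable_EFinP; exact: measurable_smu_kernel.
  by rewrite lee_fin smu_kernel_ge0.
by apply/funext => x /=; rewrite smu_densityE.
Qed.

(** Scale mixtures of uniforms decrease in every coordinate.  This is the only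
shape constraint that the consistency argument exploits: on a cell, the density
lies between its values at the two extreme corners. *)
Lemma smu_density_anti G x y : orthant x -> (forall i, x ord0 i <= y ord0 i) ->
  smu_density G y <= smu_density G x.
Proof.
move=> ox xy; rewrite -lee_fin !smu_densityE; apply: ge0_le_integral => //.
- by move=> v _; rewrite lee_fin smu_kernel_ge0.
- by apply/measurable_EFinP; exact: measurable_smu_kernelr.
- by apply/measurable_EFinP; exact: measurable_smu_kernelr.
- by move=> v _; rewrite lee_fin smu_kernel_anti.
Qed.

Lemma smu_density_tonelli G (B : set 'rV[R]_d) : measurable B ->
  (\int[leb]_(x in B) (smu_density G x)%:E =
   \int[G]_v \int[leb]_(x in B) (smu_kernel x v)%:E)%E.
Proof.
move=> mB; rewrite integral_mkcond.
under [RHS]eq_integral do rewrite integral_mkcond.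
pose h (p : 'rV[R]_d * 'rV[R]_d) := (\1_B p.1 * smu_kernel p.1 p.2)%:E.
have mh : measurable_fun setT h.
  apply/measurable_EFinP; apply: measurable_funM; last exact: measurable_smu_kernel.
  exact: (measurableT_comp (measurable_indic mB) measurable_fst).
have h0 p : (0 <= h p)%E by rewrite lee_fin mulr_ge0// smu_kernel_ge0.
have := @fubini_tonelli _ _ _ _ _ leb G h mh h0.
rewrite /h => e; transitivity (\int[leb]_x \int[G]_y h (x, y))%E.
  apply: eq_integral => x _; rewrite /h patchE/=.
  under eq_integral do rewrite EFinM.
  rewrite ge0_integralZl//=.
  - rewrite -smu_densityE indicE; case: ifPn => xB; rewrite ?mul1e ?mul0e//.
  - by apply/measurable_EFinP; exact: measurable_smu_kernelr.
  - by move=> v _; rewrite lee_fin smu_kernel_ge0.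
rewrite e; apply: eq_integral => v _; apply: eq_integral => x _.
by rewrite patchE indicE/=; case: ifPn => xB; rewrite ?mul1r ?mul0r.
Qed.

End smu_density_theory.

(** * Total mass and distribution function of the density *)

Section smu_mass.
Context {R : realType} {d : nat}.
Implicit Types (x y v a b : 'rV[R]_d) (G : probability 'rV[R]_d R).

Lemma leb_box v : (forall i, 0 <= v ord0 i) -> leb (box v) = (vol v)%:E.
Proof.
move=> v0; rewrite box_rect leb_rect => [|i]; last by rewrite mxE.
by congr EFin; apply: eq_bigr => i _; rewrite mxE subr0.
Qed.

Lemma integral_smu_kernel (B : set 'rV[R]_d) v : measurable B -> orthant v ->
  (\int[leb]_(x in B) (smu_kernel x v)%:E =
   (vol v)^-1%:E * leb (B `&` box v))%E.
Proof.
move=> mB ov; have mv := measurable_box v.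
rewrite /smu_kernel; under eq_integral do
  rewrite [\1_orthant v]indicE mem_set// mul1r EFinM.
rewrite ge0_integralZl//=.
- by rewrite integral_indic// setIC.
- by apply/measurable_EFinP/measurable_funTS/measurable_indic.
- by rewrite lee_fin invr_ge0 ltW// vol_gt0.
Qed.

Lemma smu_kernel_outside x v : ~ orthant v -> smu_kernel x v = 0.
Proof. by move=> ov; rewrite /smu_kernel indicE memNset// mul0r. Qed.

Lemma smu_density_integral G (B : set 'rV[R]_d) : measurable B ->
  (\int[leb]_(x in B) (smu_density G x)%:E =
   \int[G]_(v in orthant) ((vol v)^-1%:E * leb (B `&` box v)))%E.
Proof.
move=> mB; rewrite smu_density_tonelli// [RHS]integral_mkcond.
apply: eq_integral => v _; rewrite patchE; case: ifPn => [/set_mem ov|ov].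
  exact: integral_smu_kernel.
rewrite integral0_eq// => x _; rewrite smu_kernel_outside// => h.
by move/negP: ov; apply; apply/mem_set.
Qed.

Lemma smu_density_mass G : mixing G ->
  (\int[leb]_(x in orthant) (smu_density G x)%:E = 1)%E.
Proof.
move=> G1; rewrite smu_density_integral; last exact: measurable_orthant.
transitivity (\int[G]_(v in orthant) (cst 1 v))%E; last first.
  by rewrite integral_cst ?mul1e//; exact: measurable_orthant.
apply: eq_integral => v /set_mem ov.
rewrite setIidr; last exact: box_orthant.
rewrite leb_box => [|i]; last exact/ltW/ov.
by rewrite -EFinM mulVf// gt_eqF// vol_gt0.
Qed.

(** The proportion of the box of corner v that lies in the box of corner a. *)
Definition box_ratio a v : R := \prod_(i < d) Num.min 1 (a ord0 i / v ord0 i).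

(** The distribution function of the density at a is the expectation of
box_ratio a under the mixing distribution: convergence of the densities in L1
therefore controls the mixing distributions on the functions box_ratio a. *)
Lemma smu_density_cdf G a : (forall i, 0 <= a ord0 i) ->
  (\int[leb]_(x in box a) (smu_density G x)%:E =
   \int[G]_(v in orthant) (box_ratio a v)%:E)%E.
Proof.
move=> a0; rewrite smu_density_integral; last exact: measurable_box.
apply: eq_integral => v /set_mem ov.
pose m : 'rV[R]_d := \row_i Num.min (a ord0 i) (v ord0 i).
rewrite (_ : _ `&` _ = box m); last first.
  apply/seteqP; split => x /=.
    move=> [h1 h2] i; move: (h1 i) (h2 i); rewrite !in_itv/= mxE le_min.
    by move=> /andP[-> xa] /andP[_ xv]; rewrite xa.
  by move=> h; split => i; move: (h i); rewrite !in_itv/= mxE le_min;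
    move=> /and3P[-> ? ?].
rewrite leb_box => [|i]; last by rewrite mxE le_min a0 ltW// ov.
rewrite -EFinM; congr EFin; rewrite /vol -prodfV -big_split/=.
apply: eq_bigr => i _; rewrite mxE minC minr_pMr ?invr_ge0; last exact/ltW/ov.
by rewrite mulVf ?gt_eqF ?ov// mulrC.
Qed.

End smu_mass.

(** * The likelihood inequality *)

Section mixture.
Context {R : realType} {d : nat}.
Implicit Types (G H : probability 'rV[R]_d R).

Section mixture_probability.
Variables (G H : probability 'rV[R]_d R) (s : R) (s01 : 0 <= s <= 1).

Let s0 : 0 <= s. Proof. by case/andP: s01. Qed.
Let t0 : 0 <= 1 - s. Proof. by rewrite subr_ge0; case/andP: s01. Qed.

Definition mixture : set 'rV[R]_d -> \bar R :=
  measure_add (mscale (NngNum t0) G) (mscale (NngNum s0) H).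

HB.instance Definition _ := Measure.copy mixture
  (measure_add (mscale (NngNum t0) G) (mscale (NngNum s0) H)).

Lemma mixtureE A : mixture A = ((1 - s)%:E * G A + s%:E * H A)%E.
Proof. by rewrite /mixture measure_addE. Qed.

Let mixture_setT : mixture setT = 1%E.
Proof. by rewrite mixtureE !probability_setT !mule1 -EFinD subrK. Qed.

HB.instance Definition _ :=
  Measure_isProbability.Build _ _ _ mixture mixture_setT.

End mixture_probability.

Lemma smu_density_convex G H (s : R) : 0 <= s <= 1 -> mixing G -> mixing H ->
  exists2 K : probability 'rV[R]_d R, mixing K &
    forall x, smu_density K x = (1 - s) * smu_density G x + s * smu_density H x.
Proof.
move=> s01 G1 H1; exists (mixture G H s01 : probability _ _).
  by rewrite /mixing/= mixtureE G1 H1 !mule1 -EFinD subrK.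
move=> x; apply: EFin_inj; rewrite EFinD !EFinM !smu_densityE.
have mk : measurable_fun setT (fun v => (smu_kernel x v)%:E).
  by apply/measurable_EFinP; exact: measurable_smu_kernelr.
have k0 v : setT v -> (0 <= (smu_kernel x v)%:E)%E.
  by rewrite lee_fin smu_kernel_ge0.
rewrite [LHS]ge0_integral_measure_add//.
by rewrite !ge0_integral_mscale.
Qed.

End mixture.

Section likelihood.
Context {R : realType}.

(** A first-order expansion of the product at s = 0, with a remainder that is
uniform on the unit interval. *)
Lemma prod1Ds_lower n (y : 'I_n -> R) : (forall i, -1 <= y i) ->
  exists2 C : R, 0 <= C & forall s, 0 <= s <= 1 ->
    1 + s * (\sum_i y i) - C * s ^+ 2 <= \prod_i (1 + s * y i).
Proof.
elim: n y => [y _|n IH y y1].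
  by exists 0 => // s _; rewrite !big_ord0 mulr0 addr0 mul0r subr0.
have [C C0 hC] := IH _ (fun i => y1 (lift ord0 i)).
pose S := \sum_i y (lift ord0 i).
exists (`|S * y ord0| + C * (1 + `|y ord0|)).
  by rewrite addr_ge0// mulr_ge0// addr_ge0.
move=> s s01; have := hC _ s01; rewrite !big_ord_recl -/S; set p := \prod_i _ => hp.
have := y1 ord0; set z := y ord0 => z1; case/andP: s01 => s0 s1.
have sz : 0 <= 1 + s * z by nra.
apply: le_trans (ler_wpM2l sz hp).
have h1 := ler_norm (- (S * z)); rewrite normrN in h1.
have h2 := ler_norm (- z); have h3 := ler_norm z; rewrite normrN in h2.
have ss : 0 <= s ^+ 2 by exact: sqr_ge0.
have h4 : s ^+ 2 * - (S * z) <= s ^+ 2 * `|S * z| by exact: ler_wpM2l.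
have h5 : C * s ^+ 2 * (s * z) <= C * s ^+ 2 * `|z|.
  apply: ler_wpM2l; first exact: mulr_ge0.
  have := normr_ge0 z; nra.
nra.
Qed.

(** If s = 0 maximizes the product on the unit interval, then its right
derivative there, which is the sum, is nonpositive. *)
Lemma sum_le0_of_prod1Ds n (y : 'I_n -> R) : (forall i, -1 <= y i) ->
  (forall s, 0 <= s <= 1 -> \prod_i (1 + s * y i) <= 1) -> \sum_i y i <= 0.
Proof.
move=> y1 hp; have [C C0 hC] := prod1Ds_lower y1.
rewrite leNgt; apply/negP => S0; set S := \sum_i y i in hC S0.
(* For this s the linear gain s * S exceeds the quadratic loss C * s ^ 2. *)
pose s := Num.min 1 (S / (2 * (C + 1))).
have C1 : 0 < 2 * (C + 1) by lra.
have s0 : 0 < s by rewrite lt_min ltr01 divr_gt0.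
have s1 : s <= 1 by rewrite ge_min lexx.
have sC : s * (2 * (C + 1)) <= S by rewrite -ler_pdivlMr// ge_min lexx orbT.
have s01 : 0 <= s <= 1 by rewrite ltW.
have := le_trans (hC _ s01) (hp _ s01).
nra.
Qed.

End likelihood.

Section score.
Context {R : realType} {d : nat}.

(** Moving from the maximizer towards any other mixture stays inside the
model, because the model is convex.  The likelihood cannot increase along this
segment, so its directional derivative at the maximizer is nonpositive: this
is the stated inequality on the sum of likelihood ratios. *)
Lemma MLE_score n (X : nat -> 'rV[R]_d) (G G0 : probability 'rV[R]_d R) :
  mixing G -> mixing G0 -> is_MLE n X (smu_density G) ->
  (forall i : 'I_n, 0 < smu_density G0 (X i)) ->
  (forall i : 'I_n, 0 < smu_density G (X i)) /\
  \sum_(i < n) smu_density G0 (X i) / smu_density G (X i) <= n%:R.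
Proof.
move=> mG mG0 [_ mle] f0.
have fX i : 0 < smu_density G (X (i : 'I_n)).
  rewrite lt_neqAle smu_density_ge0 andbT eq_sym; apply/negP => /eqP fi.
  have := mle (smu_density G0) (ex_intro2 _ _ G0 mG0 erefl).
  rewrite [X in _ <= X](bigD1 i)//= fi mul0r leNgt => /negP; apply.
  exact: prodr_gt0.
split=> //; rewrite -subr_le0.
pose y (i : 'I_n) := smu_density G0 (X i) / smu_density G (X i) - 1.
rewrite (_ : _ - _ = \sum_i y i); last first.
  by rewrite /y sumrB sumr_const card_ord.
apply: sum_le0_of_prod1Ds => [i|s s01].
  by rewrite /y lerBrDr addNr divr_ge0// ltW.
have [K mK fK] := smu_density_convex s01 mG mG0.
have := mle (smu_density K) (ex_intro2 _ _ K mK erefl).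
rewrite (_ : \prod_(i < n) smu_density K (X i) =
   \prod_(i < n) smu_density G (X i) * \prod_i (1 + s * y i)); last first.
  rewrite -big_split/=; apply: eq_bigr => i _; rewrite fK /y.
  by field; rewrite gt_eqF.
by rewrite ger_pMr// prodr_gt0.
Qed.

End score.

(** * Empirical frequencies *)

Section empirical_frequency.
Context {R : realType} {d : nat}.
Variables (P : probability (sample_space R d) R) (f : 'rV[R]_d -> R).
Hypothesis iidP : iid_law P f.
Implicit Types (B C : set 'rV[R]_d).

Lemma measurable_coordinate i B : measurable B ->
  measurable [set w : sample_space R d | B (w i)].
Proof.
move=> mB; apply: sub_sigma_algebra; exists i => //.
by exists B => //; rewrite setTI.
Qed.

Lemma measurable_rectangle n (B : 'I_n -> set 'rV[R]_d) :
  (forall i, measurable (B i)) ->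
  measurable [set w : sample_space R d | forall i : 'I_n, B i (w i)].
Proof.
move=> mB; rewrite [X in measurable X](_ : _ =
    \big[setI/setT]_(i < n) [set w : sample_space R d | B i (w i)]); last first.
  rewrite -bigcap_seq; apply/seteqP; split => w /= h i; first by move=> _; exact: h.
  by apply: h; rewrite /= mem_index_enum.
by apply: bigsetI_measurable => i _; exact: measurable_coordinate.
Qed.

Definition law B : R := fine (P [set w | B (w 0%N)]).

Lemma law_density B : measurable B ->
  (\int[lebesgue_rV d]_(x in orthant `&` B) (f x)%:E)%E = (law B)%:E.
Proof.
move=> mB; rewrite fineK ?fin_num_measure//; last exact: measurable_coordinate.
have /(_ (fun=> mB)) := iidP (n := 1%N) (B := fun=> B).
rewrite big_ord_recl big_ord0 mule1 => <-; congr (P _).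
apply/seteqP; split => w /= h; first exact: (h ord0).
by move=> i; rewrite (ord1 i).
Qed.

Lemma law_rectangle n (B : 'I_n -> set 'rV[R]_d) :
  (forall i, measurable (B i)) ->
  P [set w | forall i : 'I_n, B i (w i)] = (\prod_(i < n) law (B i))%:E.
Proof.
move=> mB; rewrite iidP// -prodEFin; apply: eq_bigr => i _.
exact: law_density.
Qed.

Lemma law_ge0 B : 0 <= law B.
Proof. exact: fine_ge0. Qed.

Lemma lawC B : measurable B -> law (~` B) = 1 - law B.
Proof.
move=> mB; have mB0 := measurable_coordinate 0 mB.
apply: EFin_inj; rewrite EFinB !fineK ?fin_num_measure//; last first.
  by apply: measurable_coordinate; exact: measurableC.
by rewrite -probability_setC.
Qed.

Lemma law_le1 B : measurable B -> law B <= 1.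
Proof. by move=> mB; rewrite -subr_ge0 -lawC// law_ge0. Qed.

Lemma law_coordinate i B : measurable B ->
  P [set w | B (w i)] = (law B)%:E.
Proof.
move=> mB; pose D (k : 'I_i.+1) := if k == ord_max then B else setT.
have mD k : measurable (D k) by rewrite /D; case: ifP.
have lawT : law setT = 1 by rewrite /law probability_setT.
have -> : [set w : sample_space R d | B (w i)] =
    [set w | forall k : 'I_i.+1, D k (w k)].
  apply/seteqP; split => w /= h; last by have := h ord_max; rewrite /D eqxx.
  by move=> k; rewrite /D; case: eqP => // ->.
rewrite law_rectangle// (bigD1 ord_max)//= big1 ?mulr1 /D ?eqxx// => k.
by move=> /negPf ->.
Qed.

Definition count_in n C (w : nat -> 'rV[R]_d) : R := \sum_(i < n) \1_C (w i).

Definition pattern n C (b : {ffun 'I_n -> bool}) : set (sample_space R d) :=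
  [set w | forall i : 'I_n, (if b i then C else ~` C) (w i)].

Lemma rare_eq_patterns n C (x : R) :
  [set w : sample_space R d | count_in n C w < x] =
  \big[setU/set0]_(b : {ffun 'I_n -> bool} | \sum_(i < n) (b i)%:R < x) pattern C b.
Proof.
rewrite -bigcup_seq_cond; apply/seteqP; split => [w wx|w [b /= /andP[_ bx] hb]].
  exists [ffun i : 'I_n => w i \in C]; rewrite /= ?mem_index_enum/=.
    by move: wx; congr (_ < _); apply: eq_bigr => i _; rewrite ffunE indicE.
  by move=> i; rewrite ffunE; case: ifPn => [/set_mem|/negP h /mem_set].
rewrite /= (_ : count_in n C w = \sum_(i < n) (b i)%:R)//.
apply: eq_bigr => i _; rewrite indicE; have := hb i.
by case: (b i) => [/mem_set ->//|/= h]; rewrite memNset.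
Qed.

Lemma measurable_pattern n C (b : {ffun 'I_n -> bool}) : measurable C ->
  measurable (pattern C b).
Proof.
move=> mC; apply: (measurable_rectangle (B := fun i => if b i then C else ~` C)).
move=> i.
by case: (b i) => //; exact: measurableC.
Qed.

Lemma measurable_rare n C (x : R) : measurable C ->
  measurable [set w : sample_space R d | count_in n C w < x].
Proof.
move=> mC; rewrite rare_eq_patterns; apply: bigsetU_measurable => b _.
by apply: measurable_pattern.
Qed.

(** Chernoff's bound for the lower tail, with the moment generating function of
the indicator taken at - e.  The rare event is a finite disjunction over the
subsets of indices that fall in C, so the expectation of the exponential is a
finite sum that factors over the sample; only the probabilities of rectangles
are used. *)
Lemma rare_prob n C (e t : R) : measurable C -> 0 <= e ->
  (P [set w | (count_in n C w < n%:R * t)%R] <=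
   ((expR (e * t) * (1 - law C * (1 - expR (- e)))) ^+ n)%:E)%E.
Proof.
move=> mC e0; rewrite rare_eq_patterns.
(* The exponential weight of one observation; on the rare event the product of
   the weights is at least 1. *)
pose g (c : bool) : R := expR (e * (t - c%:R)).
pose mu (c : bool) := law (if c then C else ~` C).
have mC' (c : bool) : measurable (if c then C else ~` C).
  by case: c => //; exact: measurableC.
apply: (@le_trans _ _ (\sum_(b : {ffun 'I_n -> bool} |
    (\sum_(i < n) (b i)%:R < n%:R * t)%R) P (pattern C b))%E).
  pose K (A : set (sample_space R d)) y := measurable A /\ (P A <= y)%E.
  suff: K (\big[setU/set0]_(b : {ffun 'I_n -> bool} |
    \sum_(i < n) (b i)%:R < n%:R * t) pattern C b)
    (\sum_(b : {ffun 'I_n -> bool} |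
    (\sum_(i < n) (b i)%:R < n%:R * t)%R) P (pattern C b))%E by case.
  apply: (big_rec2 K) => [|b A y _ [mA Ay]]; first by split; rewrite ?measure0.
  have mb : measurable (pattern C b) by apply: measurable_pattern.
  split; first exact: measurableU.
  by apply: le_trans (measureU2 _ mb mA) _; exact: leeD2l.
rewrite (eq_bigr (fun b : {ffun 'I_n -> bool} => (\prod_(i < n) mu (b i))%:E)); last first.
  move=> b _; exact: (law_rectangle (B := fun i => if b i then C else ~` C)).
rewrite sumEFin lee_fin.
apply: (@le_trans _ _ (\sum_(b : {ffun 'I_n -> bool}) \prod_(i < n) (g (b i) * mu (b i)))).
  rewrite big_mkcond/=; apply: ler_sum => b _.
  have p0 : 0 <= \prod_(i < n) mu (b i) by apply: prodr_ge0 => i _; exact: law_ge0.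
  rewrite big_split/= /g -expR_sum.
  case: ifPn => [bt|_]; last by rewrite mulr_ge0// expR_ge0.
  rewrite ler_peMl// -[leLHS]expR0 ler_expR -mulr_sumr mulr_ge0//.
  rewrite sumrB sumr_const card_ord subr_ge0.
  by rewrite -[leRHS]mulr_natl ltW.
rewrite -(bigA_distr_bigA (fun (_ : 'I_n) c => g c * mu c)) prodr_const card_ord.
rewrite big_bool/= (_ : g true * _ + _ =
    expR (e * t) * (1 - law C * (1 - expR (- e))))//.
rewrite /g /mu lawC// mulrBr mulr1 expRD subr0; ring.
Qed.

(** Taking the exponent equal to the relative deviation e suffices, because
(1 - e + e ^ 2) * (1 + e) = 1 + e ^ 3 > 1 while expR (- e) * (1 + e) <= 1. *)
Lemma chernoff_base_lt1 (p e : R) : 0 < p -> 0 < e ->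
  expR (e * ((1 - e) * p)) * (1 - p * (1 - expR (- e))) < 1.
Proof.
move=> p0 e0; have h1 : 1 - p * (1 - expR (- e)) <= expR (- (p * (1 - expR (- e)))).
  exact: expR_ge1Dx.
apply: le_lt_trans (ler_wpM2l (expR_ge0 _) h1) _.
rewrite -expRD -[ltRHS]expR0 ltr_expR.
have h2 : expR (- e) * (1 + e) <= 1.
  by rewrite expRN mulrC ler_pdivrMr ?expR_gt0// mul1r expR_ge1Dx.
have h3 : 0 < e ^+ 3 by rewrite exprn_gt0.
have h4 : expR (- e) < 1 - e + e ^+ 2.
  have h5 : 0 < 1 + e by lra.
  rewrite -(ltr_pM2r h5); apply: le_lt_trans h2 _.
  by rewrite (_ : _ * _ = 1 + e ^+ 3); [lra|ring].
nra.
Qed.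

(** The lower half of the strong law of large numbers for indicators.  The rare
events have geometrically decreasing probabilities, so the Borel-Cantelli lemma
applies.  The deviation is relative to the probability of C, which is what
makes the bound usable after division by a value of the estimator. *)
Lemma ae_count_in_ge C (e : R) : measurable C -> 0 < e < 1 ->
  {ae P, forall w, \forall n \near \oo,
    (1 - e) * law C * n%:R <= count_in n C w}.
Proof.
move=> mC /andP[e0 e1].
have [p0|p0] := leP (law C) 0.
  apply/aeW => w; apply: nearW => n.
  rewrite (_ : law C = 0) ?mulr0 ?mul0r; last by apply/le_anti; rewrite p0 law_ge0.
  by apply: sumr_ge0 => i _.
pose F n := [set w : sample_space R d | count_in n C w < n%:R * ((1 - e) * law C)].
have mF n : measurable (F n) by exact: measurable_rare.
pose r := expR (e * ((1 - e) * law C)) * (1 - law C * (1 - expR (- e))).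
have r1 : r < 1 by exact: chernoff_base_lt1.
have r0 : 0 < r.
  rewrite mulr_gt0 ?expR_gt0// subr_gt0.
  have := law_le1 mC; have := expR_gt0 (- e); nra.
have sF : (\sum_(n <oo) P (F n) < +oo)%E.
  apply: (@le_lt_trans _ _ (1 / (1 - r))%:E); last exact: ltry.
  apply: lime_le; first exact: is_cvg_nneseries.
  apply: nearW => n.
  have := @geometric_le_lim R n 1 r ler01 r0; rewrite (ger0_norm (ltW r0)) => /(_ r1).
  rewrite -lee_fin; apply: le_trans.
  rewrite /series/= -sumEFin; apply: lee_sum => k _.
  by rewrite mul1r; apply: rare_prob => //; exact: ltW.
exists (lim_sup_set F); split.
- by apply: bigcapT_measurable => n; apply: bigcup_measurable.
- exact: lim_sup_set_cvg0.
move=> w /= wF n _; apply: contrapT => wN; apply: wF.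
exists n => // m /= nm; rewrite mulrC leNgt; apply/negP => wm.
by apply: wN; exists m.
Qed.

End empirical_frequency.

(** * Geometric grids *)

Section geometric_grid.
Context {R : realType} {d N : nat}.
Implicit Types (x : 'rV[R]_d) (a r : R) (j : {ffun 'I_d -> 'I_N}).

Definition node a r j : 'rV[R]_d := \row_i (a * r ^+ j i).

(** The upper corners of the cells with base point a are the lower corners of
the cells with base point a * r, and passing from the former cells to the
latter multiplies all volumes by r ^ d.  Upper and lower Riemann sums of a
decreasing function can thus be compared by shifting the base point. *)
Definition cell a r j : set 'rV[R]_d := rect (node a r j) (node (a * r) r j).

Definition cell_vol a r j : R := \prod_(i < d) (a * r ^+ j i * (r - 1)).

Definition slab a r : set 'rV[R]_d :=
  rect (const_mx a) (const_mx (a * r ^+ N)).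

Lemma orthant_node a r j : 0 < a -> 0 < r -> orthant (node a r j).
Proof. by move=> a0 r0 i; rewrite mxE mulr_gt0// exprn_gt0. Qed.

Lemma leb_cell a r j : 0 < a -> 1 < r -> leb (cell a r j) = (cell_vol a r j)%:E.
Proof.
move=> a0 r1; have r0 : 0 < r by exact: lt_trans r1.
rewrite leb_rect => [|i]; last first.
  by rewrite !mxE mulrAC ler_peMr ?(ltW r1)// mulr_ge0 ?exprn_ge0 ?ltW.
by congr EFin; apply: eq_bigr => i _; rewrite !mxE; ring.
Qed.

Lemma cell_vol_gt0 a r j : 0 < a -> 1 < r -> 0 < cell_vol a r j.
Proof.
move=> a0 r1; have r0 : 0 < r by exact: lt_trans r1.
by apply: prodr_gt0 => i _; rewrite !mulr_gt0 ?exprn_gt0 ?subr_gt0.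
Qed.

Lemma cell_volM a r s j : cell_vol (s * a) r j = s ^+ d * cell_vol a r j.
Proof.
rewrite -[X in s ^+ X](card_ord d) -prodr_const -big_split/=.
by apply: eq_bigr => i _; rewrite !mulrA.
Qed.

Lemma sum_geometric_itv (t a r : R) : 0 < a -> 1 < r ->
  \sum_(k < N) \1_(`]a * r ^+ k, a * r * r ^+ k]%classic) t =
  \1_(`]a, a * r ^+ N]%classic) t :> R.
Proof.
move=> a0 r1; have r0 : 0 < r by exact: lt_trans r1.
elim: N => [|n IH].
  by rewrite big_ord0 expr0 mulr1 set_itv_ge ?indic0// bnd_simp ltxx.
rewrite big_ord_recr/= {}IH !indicE -mulrA -exprS.
have h1 : a * r ^+ n <= a * r ^+ n.+1.
  by rewrite ler_pM2l// exprS ler_peMl ?(ltW r1)// exprn_ge0 ?ltW.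
have h2 : a <= a * r ^+ n.
  by rewrite ler_peMr ?(ltW a0)// exprn_ege1 ?ltW.
rewrite !mem_setE !in_itv/=.
have [ta|ta] := ltP a t => /=; last first.
  by rewrite ltNge (le_trans ta)//= addr0.
have [tn|tn] := leP t (a * r ^+ n) => /=; first by rewrite (le_trans tn h1) addr0.
by rewrite add0r.
Qed.

Lemma indic_rect (x a b : 'rV[R]_d) :
  \1_(rect a b) x = \prod_(i < d) \1_(`]a ord0 i, b ord0 i]%classic) (x ord0 i) :> R.
Proof.
have [h|h] := pselect (rect a b x).
  rewrite indicE mem_set// big1// => i _; rewrite indicE mem_set//.
  exact: (h i).
rewrite indicE memNset//.
have /existsNP[i hi] : ~ forall i, x ord0 i \in `]a ord0 i, b ord0 i] by [].
by rewrite (bigD1 i)//= [X in X * _]indicE memNset ?mul0r.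
Qed.

Lemma sum_indic_cell a r x : 0 < a -> 1 < r ->
  \sum_j \1_(cell a r j) x = \1_(slab a r) x :> R.
Proof.
move=> a0 r1; rewrite indic_rect.
under [RHS]eq_bigr do rewrite !mxE -sum_geometric_itv//.
rewrite (bigA_distr_bigA (fun i (k : 'I_N) =>
  \1_(`]a * r ^+ k, a * r * r ^+ k]%classic) (x ord0 i))).
by apply: eq_bigr => j _; rewrite indic_rect; apply: eq_bigr => i _; rewrite !mxE.
Qed.

(** At a point of the slab exactly one term of the sum is nonzero, since the
cells partition the slab. *)
Lemma step_le a r x (c : {ffun 'I_d -> 'I_N} -> R) (g : R) : 0 < a -> 1 < r ->
  0 <= g -> (forall j, cell a r j x -> c j <= g) ->
  \sum_j c j * \1_(cell a r j) x <= g * \1_(slab a r) x.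
Proof.
move=> a0 r1 g0 cg; rewrite -sum_indic_cell// mulr_sumr; apply: ler_sum => j _.
have [xj|xj] := pselect (cell a r j x); rewrite indicE.
  by rewrite mem_set// !mulr1 cg.
by rewrite memNset// !mulr0.
Qed.

Lemma step_ge a r x (c : {ffun 'I_d -> 'I_N} -> R) (g : R) : 0 < a -> 1 < r ->
  (forall j, cell a r j x -> g <= c j) ->
  g * \1_(slab a r) x <= \sum_j c j * \1_(cell a r j) x.
Proof.
move=> a0 r1 cg; rewrite -sum_indic_cell// mulr_sumr; apply: ler_sum => j _.
have [xj|xj] := pselect (cell a r j x); rewrite indicE.
  by rewrite mem_set// !mulr1 cg.
by rewrite memNset// !mulr0.
Qed.

Lemma cell_orthant a r j x : 0 < a -> 0 < r -> cell a r j x -> orthant x.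
Proof.
move=> a0 r0 h i; have := h i; rewrite !mxE in_itv/= => /andP[+ _].
by apply: lt_trans; rewrite mulr_gt0// exprn_gt0.
Qed.

Lemma measurable_step a r (c : {ffun 'I_d -> 'I_N} -> R) :
  measurable_fun setT (fun x => \sum_j c j * \1_(cell a r j) x).
Proof.
apply: measurable_sum => j; apply: measurable_funM => //.
by apply: measurable_indic; exact: measurable_rect.
Qed.

Lemma step_ge0 a r (c : {ffun 'I_d -> 'I_N} -> R) x : (forall j, 0 <= c j) ->
  0 <= \sum_j c j * \1_(cell a r j) x.
Proof. by move=> c0; apply: sumr_ge0 => j _; rewrite mulr_ge0. Qed.

Lemma integral_step a r (c : {ffun 'I_d -> 'I_N} -> R) : 0 < a -> 1 < r ->
  (forall j, 0 <= c j) ->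
  (\int[leb]_(x in orthant) (\sum_j c j * \1_(cell a r j) x)%:E =
   (\sum_j c j * cell_vol a r j)%:E)%E.
Proof.
move=> a0 r1 c0; have mO := @measurable_orthant R d.
under eq_integral do rewrite -sumEFin.
rewrite ge0_integral_sum//; last 2 first.
- move=> j; apply/measurable_EFinP/measurable_funTS; apply: measurable_funM => //.
  by apply: measurable_indic; exact: measurable_rect.
- by move=> j x _; rewrite lee_fin mulr_ge0.
rewrite -sumEFin; apply: eq_bigr => j _.
have mc : measurable (cell a r j) by exact: measurable_rect.
under eq_integral do rewrite EFinM.
rewrite ge0_integralZl//=.
- rewrite integral_indic// setIidl.
    by rewrite [X in (_ * X)%E]leb_cell.
  by move=> x; apply: cell_orthant => //; exact: lt_trans r1.
- by apply/measurable_EFinP/measurable_funTS/measurable_indic.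
- by rewrite lee_fin.
Qed.

End geometric_grid.

(** * A deterministic bound on the L1 distance *)

Section grid_bound.
Context {R : realType} {d N : nat}.
Variables (G G0 : probability 'rV[R]_d R).
Hypotheses (mG : mixing G) (mG0 : mixing G0).
Let f := smu_density G.
Let f0 := smu_density G0.
Let mO := @measurable_orthant R d.

Let mf : measurable_fun orthant f.
Proof. by apply: measurable_funTS; exact: measurable_smu_density. Qed.

Let mf0 : measurable_fun orthant f0.
Proof. by apply: measurable_funTS; exact: measurable_smu_density. Qed.

(** Both densities have mass 1, so the excess of f over f0 and its deficit have
the same integral. *)
Lemma L1_distance_deficit : L1_distance f f0 =
  (2%:E * \int[leb]_(x in orthant) (Num.max (f0 x - f x) 0)%:E)%E.
Proof.
pose D x := Num.max (f0 x - f x) 0.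
have mD : measurable_fun orthant D.
   by apply: measurable_maxr => //; exact: measurable_funB.
have D0 x : 0 <= D x by rewrite le_max lexx orbT.
have Df0 x : D x <= f0 x by rewrite ge_max !smu_density_ge0 andbT gerBl smu_density_ge0.
have e : (L1_distance f f0 + 1 = 1 + 2%:E * \int[leb]_(x in orthant) (D x)%:E)%E.
  rewrite -{1}(smu_density_mass mG0) -{1}(smu_density_mass mG) -ge0_integralZl//=.
  - rewrite -[RHS]ge0_integralD//=.
    + rewrite -[LHS]ge0_integralD//=.
      * apply: eq_integral => x _; rewrite -EFinM -!EFinD; congr EFin.
        rewrite /D -/f -/f0; case: (leP (f0 x) (f x)) => h.
          by rewrite ger0_norm ?subr_ge0// max_r ?subr_le0//; ring.
        by rewrite ltr0_norm ?subr_lt0// max_l ?subr_ge0 ?ltW//; ring.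
      * apply/measurable_EFinP; apply: measurableT_comp => //.
        exact: measurable_funB.
      * by move=> x _; rewrite lee_fin smu_density_ge0.
      * exact/measurable_EFinP.
    + by move=> x _; rewrite lee_fin smu_density_ge0.
    + exact/measurable_EFinP.
    + by move=> x _; rewrite lee_fin mulr_ge0.
    + by apply/measurable_EFinP/measurable_funM.
  - exact/measurable_EFinP.
  - by move=> x _; rewrite lee_fin.
have : (\int[leb]_(x in orthant) (D x)%:E \is a fin_num)%E.
  rewrite ge0_fin_numE; last by apply: integral_ge0 => x _; rewrite lee_fin.
  apply: le_lt_trans (ltry 1); rewrite -(smu_density_mass mG0).
  by apply: ge0_le_integral => //; [move=> x _; rewrite lee_fin|
    exact/measurable_EFinP|exact/measurable_EFinP|move=> x _; rewrite lee_fin].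
move=> fD; move: e; rewrite -(fineK fD) addeC -EFinM.
by move/(congr1 (fun z => z - 1)%E); rewrite addeAC subee// add0e => ->;
  rewrite addeAC subee// add0e.
Qed.

Variables (law : set 'rV[R]_d -> R).
Hypothesis lawE : forall B, measurable B ->
  (\int[lebesgue_rV d]_(x in orthant `&` B) (f0 x)%:E)%E = (law B)%:E.

Variables (n : nat) (X : nat -> 'rV[R]_d) (a r e : R).
Hypotheses (n0 : (0 < n)%N) (a0 : 0 < a) (r1 : 1 < r) (e01 : 0 < e < 1).
Hypothesis fX : forall i : 'I_n, 0 < f (X i).
Hypothesis score : \sum_(i < n) f0 (X i) / f (X i) <= n%:R.
Hypothesis freq : forall j : {ffun 'I_d -> 'I_N},
  (1 - e) * law (cell a r j) * n%:R <= count_in n (cell a r j) X.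

Let r0 : 0 < r. Proof. exact: lt_trans r1. Qed.
(* On the cell of index j, the estimator is at most q j and the true density is
   at least p j. *)
Let q (j : {ffun 'I_d -> 'I_N}) := f (node a r j).
Let p (j : {ffun 'I_d -> 'I_N}) := f0 (node (a * r) r j).
Let c (j : {ffun 'I_d -> 'I_N}) := cell_vol a r j.
(* The cells with base point b precede those with base point a: on them the
   estimator is at least q j. *)
Let b := r^-1 * a.
Let u := r^-1 ^+ d.

Let q0 j : 0 <= q j. Proof. exact: smu_density_ge0. Qed.
Let p0 j : 0 <= p j. Proof. exact: smu_density_ge0. Qed.
Let c0 j : 0 < c j. Proof. exact: cell_vol_gt0. Qed.
Let b0 : 0 < b. Proof. by rewrite mulr_gt0 ?invr_gt0. Qed.
Let br : b * r = a. Proof. by rewrite /b mulrAC mulVf ?mul1r// gt_eqF. Qed.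
Let u0 : 0 < u. Proof. by rewrite exprn_gt0// invr_gt0. Qed.
Let ur : u * r ^+ d = 1. Proof. by rewrite -exprMn mulVf ?expr1n// gt_eqF. Qed.

Let rect_lower (lo hi x : 'rV[R]_d) i : rect lo hi x -> lo ord0 i <= x ord0 i.
Proof. by move=> /(_ i); rewrite in_itv/= => /andP[/ltW]. Qed.

Let rect_upper (lo hi x : 'rV[R]_d) i : rect lo hi x -> x ord0 i <= hi ord0 i.
Proof. by move=> /(_ i); rewrite in_itv/= => /andP[]. Qed.

(** The upper sum of f over the cells of base point a is, up to the factor
r ^ d, a lower sum of f over the preceding cells, hence at most r ^ d. *)
Lemma grid_upper_sum : \sum_j q j * c j <= r ^+ d.
Proof.
suff : \sum_j q j * cell_vol b r j <= 1.
  under eq_bigr do rewrite cell_volM mulrCA.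
  by rewrite -mulr_sumr -/u => h; rewrite -(ler_pM2l u0) ur.
rewrite -lee_fin -integral_step// -(smu_density_mass mG).
apply: ge0_le_integral => //.
- by move=> x _; rewrite lee_fin step_ge0.
- by apply/measurable_EFinP; apply: measurable_funTS; exact: measurable_step.
- exact/measurable_EFinP.
- move=> x ox; rewrite lee_fin; apply: (le_trans (step_le b0 r1 (smu_density_ge0 G x) _)).
    move=> j xj; apply: smu_density_anti => // i.
    by rewrite -br; exact: rect_upper xj.
  by rewrite ler_piMr ?smu_density_ge0// indicE; case: (_ \in _).
Qed.

(** Dually, the lower sum of f0 is, up to the factor r ^ d, an upper sum of f0
over the cells of base point a * r. *)
Lemma grid_lower_sum : u * law (@slab R d N (a * r) r) <= \sum_j p j * c j.
Proof.
have ar0 : 0 < a * r by exact: mulr_gt0.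
have ms : measurable (@slab R d N (a * r) r) by exact: measurable_rect.
suff : law (@slab R d N (a * r) r) <= \sum_j p j * cell_vol (a * r) r j.
  under eq_bigr do rewrite mulrC (mulrC _ r) cell_volM -mulrA (mulrC _ (p _)).
  by rewrite -mulr_sumr => h; rewrite -(ler_pM2l u0) in h; rewrite mulrA ur mul1r in h.
rewrite -lee_fin -integral_step// -lawE// integral_mkcondr.
apply: ge0_le_integral => //.
- by move=> x _; apply: erestrict_ge0 => y _; rewrite lee_fin smu_density_ge0.
- apply/measurable_restrict => //.
  by apply/measurable_EFinP; apply: measurable_funTS; exact: measurable_smu_density.
- by apply/measurable_EFinP; apply: measurable_funTS; exact: measurable_step.
- move=> x ox; rewrite patchE.
  apply: (@le_trans _ _ (f0 x * \1_(@slab R d N (a * r) r) x)%:E).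
    by rewrite indicE; case: ifPn => _; rewrite ?mulr1 ?mulr0.
  rewrite lee_fin; apply: step_ge => // j xj.
  apply: smu_density_anti => [|i]; first exact: orthant_node.
  exact: rect_lower xj.
Qed.

Lemma cell_mass_ge j : c j * p j <= law (cell a r j).
Proof.
have mc : measurable (cell a r j) by exact: measurable_rect.
have co : cell a r j `<=` orthant by move=> x; exact: cell_orthant.
rewrite -lee_fin -lawE// setIidr// mulrC EFinM -[(c j)%:E](leb_cell j a0 r1).
rewrite -(integral_cst leb mc (p j)%:E); apply: ge0_le_integral => //.
- by move=> x _; rewrite lee_fin.
- by apply/measurable_EFinP; apply: measurable_funTS; exact: measurable_smu_density.
- move=> x xj; rewrite lee_fin; apply: smu_density_anti => [|i]; first exact: co.
  exact: rect_upper xj.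
Qed.

(** A cell with p j > 0 has positive probability, so it contains an
observation, at which f is positive.  Hence p j = 0 wherever the ratios
p j / q j have a zero denominator. *)
Lemma visited_cell j : 0 < p j -> 0 < q j.
Proof.
move=> pj; rewrite lt_neqAle q0 andbT eq_sym; apply/negP => /eqP qj.
have : 0 < count_in n (cell a r j) X.
  apply: lt_le_trans (freq j); rewrite !mulr_gt0 ?ltr0n ?subr_gt0//.
    by case/andP: e01.
  by apply: lt_le_trans (cell_mass_ge j); rewrite mulr_gt0.
rewrite /count_in big1 ?ltxx// => i _; rewrite indicE memNset// => Xj.
have := fX i; rewrite ltNge => /negP; apply; rewrite -qj.
apply: smu_density_anti => [|k]; first exact: orthant_node.
exact: rect_lower Xj.
Qed.

(** The likelihood inequality, with the densities replaced by their bounds on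
the cells and the empirical frequencies by the probabilities of the cells.  The
sum approximates the integral of f0 ^ 2 / f from below. *)
Lemma grid_score : (1 - e) * (\sum_j p j ^+ 2 / q j * c j) <= 1.
Proof.
have n0' : 0 < n%:R :> R by rewrite ltr0n.
rewrite -(ler_pM2l n0') mulr1; apply: le_trans score.
apply: (@le_trans _ _ (\sum_(i < n) \sum_j p j / q j * \1_(cell a r j) (X i))).
  rewrite exchange_big/= mulrA mulr_sumr; apply: ler_sum => j _.
  rewrite -mulr_sumr -/(count_in n (cell a r j) X).
  apply: (@le_trans _ _ (p j / q j * ((1 - e) * law (cell a r j) * n%:R))); last first.
    by apply: ler_wpM2l => //; exact: divr_ge0.
  rewrite [leLHS](_ : _ = p j / q j * ((1 - e) * (c j * p j) * n%:R)); last first.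
    by rewrite expr2; ring.
  apply: ler_wpM2l; first exact: divr_ge0.
  apply: ler_wpM2r => //; apply: ler_wpM2l; last exact: cell_mass_ge.
  by rewrite subr_ge0; case/andP: e01 => _ /ltW.
apply: ler_sum => i _.
have g0 : 0 <= f0 (X i) / f (X i) by rewrite divr_ge0// smu_density_ge0.
apply: (le_trans (step_le a0 r1 g0 _)); last first.
  by rewrite ler_piMr// indicE; case: (_ \in _).
move=> j Xj.
have fq : f (X i) <= q j.
  apply: smu_density_anti => [|k]; first exact: orthant_node.
  exact: rect_lower Xj.
apply: ler_pM => //; first by rewrite invr_ge0.
  apply: smu_density_anti => [|k]; last exact: rect_upper Xj.
  exact: cell_orthant Xj.
move: (fX i) fq; move: (f (X i)) (q j) => y z y0 yz.
by rewrite lef_pV2// posrE// (lt_le_trans y0).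
Qed.

(** The identity p ^ 2 / q - 2 p + q = (p - q) ^ 2 / q turns the three previous
estimates into a bound on a chi-square distance between the step functions p
and q.  Cauchy's inequality 2 z <= z ^ 2 / (t q) + t q, applied with z = p - q,
passes from there to the L1 distance. *)
Lemma grid_excess (t : R) : 0 < t ->
  2 * (\sum_j Num.max (p j - q j) 0 * c j) <=
  t^-1 * ((1 - e)^-1 - 2 * (u * law (@slab R d N (a * r) r)) + r ^+ d) + t * r ^+ d.
Proof.
move=> t0.
have e1 : 0 < 1 - e by rewrite subr_gt0; case/andP: e01.
have h1 := grid_upper_sum; have h2 := grid_lower_sum; have h3 := grid_score.
have h4 : \sum_j p j ^+ 2 / q j * c j <= (1 - e)^-1.
  by rewrite -[leRHS]mul1r ler_pdivlMr// mulrC.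
apply: (@le_trans _ _ (t^-1 * (\sum_j p j ^+ 2 / q j * c j - 2 * (\sum_j p j * c j)
   + \sum_j q j * c j) + t * \sum_j q j * c j)); last first.
  apply: lerD; last by rewrite ler_wpM2l// ltW.
  apply: ler_wpM2l; first by rewrite invr_ge0 ltW.
  lra.
rewrite !mulr_sumr -sumrN -!big_split/= mulr_sumr -big_split/=.
apply: ler_sum => j _; have cj := c0 j; have pj := p0 j.
rewrite [leRHS](_ : _ = (t^-1 * (p j ^+ 2 / q j - 2 * p j + q j) + t * q j) * c j); last by ring.
rewrite mulrA; apply: ler_wpM2r; first exact: ltW.
have := q0 j; rewrite le_eqVlt => /orP[/eqP qj|qj].
  have -> : p j = 0.
    apply/eqP/negPn/negP => pn; have := @visited_cell j.
    by rewrite lt_neqAle eq_sym pn pj -qj ltxx => /(_ isT).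
  by rewrite -qj subrr maxxx invr0 expr2 !mul0r !mulr0 subr0 !addr0 mulr0.
rewrite (_ : p j ^+ 2 / q j - 2 * p j + q j = (p j - q j) ^+ 2 / q j); last first.
  by field; rewrite gt_eqF.
set z := p j - q j.
have -> : t^-1 * (z ^+ 2 / q j) + t * q j = (z ^+ 2 + (t * q j) ^+ 2) / (t * q j).
  by field; rewrite !gt_eqF.
have tq : 0 < t * q j by rewrite mulr_gt0.
rewrite ler_pdivlMr//; set y := t * q j in tq *.
case: (leP z 0) => z0; first by rewrite mulr0 mul0r addr_ge0// sqr_ge0.
have := sqr_ge0 (z - y); nra.
Qed.

(** On the cell of index j with base point b, both f >= q j and f0 >= p j, so
that the deficit f0 - f is at most (f0 - p j) + max (p j - q j) 0; outside of
the cells it is at most f0. *)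
Lemma grid_deficit : (\int[leb]_(x in orthant) (Num.max (f0 x - f x) 0)%:E <=
  (1 - u * (\sum_j p j * c j) + u * (\sum_j Num.max (p j - q j) 0 * c j))%:E)%E.
Proof.
pose D x := Num.max (f0 x - f x) 0.
pose m j := Num.max (p j - q j) 0.
have mD : measurable_fun orthant D.
   by apply: measurable_maxr => //; exact: measurable_funB.
have D0 x : 0 <= D x by rewrite le_max lexx orbT.
have m0 j : 0 <= m j by rewrite le_max lexx orbT.
have uE (z : {ffun 'I_d -> 'I_N} -> R) :
    \sum_j z j * cell_vol b r j = u * \sum_j z j * c j.
  by under eq_bigr do rewrite cell_volM mulrCA; rewrite -mulr_sumr.
have mst z := measurable_funTS (D := orthant) (@measurable_step R d N b r z).
suff : (\int[leb]_(x in orthant) (D x)%:E + (\sum_j p j * cell_vol b r j)%:E <=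
  1 + (\sum_j m j * cell_vol b r j)%:E)%E.
  rewrite !uE -leeBrDr// => /le_trans; apply.
  by rewrite -[X in (X - _)%E]EFinD -EFinB lee_fin addrAC.
rewrite -!integral_step// -(smu_density_mass mG0) -!ge0_integralD//; last 8 first.
- by move=> x _; rewrite lee_fin smu_density_ge0.
- exact/measurable_EFinP.
- by move=> x _; rewrite lee_fin step_ge0.
- exact/measurable_EFinP.
- by move=> x _; rewrite lee_fin.
- exact/measurable_EFinP.
- by move=> x _; rewrite lee_fin step_ge0.
- exact/measurable_EFinP.
apply: ge0_le_integral => //.
- by move=> x _; rewrite adde_ge0// lee_fin// step_ge0.
- by apply: emeasurable_funD; exact/measurable_EFinP.
- by apply: emeasurable_funD; exact/measurable_EFinP.
move=> x ox; rewrite -!EFinD lee_fin -lerBrDr -addrA -lerBlDl.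
apply: (@le_trans _ _ ((D x - f0 x) * \1_(@slab R d N b r) x)).
  have : D x - f0 x <= 0.
    by rewrite subr_le0 ge_max smu_density_ge0 andbT gerBl smu_density_ge0.
  by rewrite indicE; case: (_ \in _); rewrite ?mulr1 ?mulr0.
apply: (@le_trans _ _ (\sum_j (m j - p j) * \1_(cell b r j) x)); last first.
  by rewrite -sumrB; apply: ler_sum => j _; rewrite mulrBl.
apply: step_ge => // j xj.
have fq : q j <= f x.
  apply: smu_density_anti => // i.
  by rewrite -br; exact: rect_upper xj.
have fp : p j <= f0 x.
  apply: smu_density_anti => // i; apply: le_trans (rect_upper i xj) _.
  rewrite br !mxE mulrAC ler_peMr ?(ltW r1)// mulr_ge0 ?(ltW a0)//.
  by rewrite exprn_ge0// ltW.
rewrite /D /m; have := leP (f0 x - f x) 0; have := leP (p j - q j) 0.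
rewrite -/f -/f0; case=> h1; case=> h2; lra.
Qed.

(** The bound is small when r and 1 - e are close to 1, the slab has almost
full probability, and t is small but large compared with the resulting error.
It depends on the sample only through the hypotheses on frequencies and
likelihood ratios. *)
Lemma grid_bound (t s : R) : 0 < t -> s = law (@slab R d N (a * r) r) ->
  (L1_distance f f0 <= (2 * (1 - u ^+ 2 * s) +
    (t^-1 * ((1 - e)^-1 - 2 * (u * s) + r ^+ d) + t * r ^+ d))%:E)%E.
Proof.
move=> t0 sE; rewrite L1_distance_deficit.
apply: (le_trans (lee_wpmul2l _ grid_deficit)); first by rewrite lee_fin.
rewrite -EFinM lee_fin.
have h1 := grid_excess t0; have h2 := grid_lower_sum; rewrite -sE in h1 h2.
set M := \sum_j Num.max _ _ * _ in h1 *; set S := \sum_j _ * _ in h2 *.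
have u1 : u <= 1.
  by rewrite exprn_ile1// ?invr_ge0 ?invf_le1// ltW.
have M0 : 0 <= M.
  by apply: sumr_ge0 => j _; rewrite mulr_ge0 ?(ltW (c0 j))// le_max lexx orbT.
have : u * M <= M by rewrite ler_piMl.
have : u * (u * s) <= u * S by rewrite ler_pM2l.
have -> : u ^+ 2 * s = u * (u * s) by ring.
lra.
Qed.

End grid_bound.

(** * Almost sure L1 convergence *)

Section strong_L1_consistency.
Context {R : realType}.

Lemma cvge0_of_le (u : nat -> \bar R) : (forall n, 0 <= u n)%E ->
  (forall e : R, 0 < e -> \forall n \near \oo, (u n <= e%:E)%E) ->
  u n @[n --> \oo] --> 0%E.
Proof.
move=> u0 ue.
have fu e : 0 < e -> \forall n \near \oo, (u n \is a fin_num) /\ fine (u n) <= e.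
  move=> e0; have := ue _ e0; apply: filterS => n un.
  have fn : u n \is a fin_num by rewrite ge0_fin_numE// (le_lt_trans un) ?ltry.
  by split=> //; rewrite -lee_fin fineK.
apply/fine_cvgP; split; first by have := fu _ ltr01; apply: filterS => n [].
apply/cvgrPdist_le => e e0; have := fu _ e0; apply: filterS => n [fn un].
by rewrite sub0r normrN ger0_norm// fine_ge0.
Qed.

Lemma exists_ratio_pow_le (d : nat) (s : R) : 0 < s ->
  exists m : nat, (1 + m.+1%:R^-1) ^+ d <= 1 + s.
Proof.
move=> s0.
have h : (1 + n.+1%:R^-1 : R) ^+ d @[n --> \oo] --> (1 : R).
  have h1 : (1 + n.+1%:R^-1 : R) @[n --> \oo] --> (1 : R).
    by rewrite -[X in _ --> X]addr0; apply: cvgD; [exact: cvg_cst|exact: cvg_harmonic].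
  by have := cvg_comp _ _ h1 (@exprn_continuous R d 1); rewrite expr1n.
have : \forall n \near \oo, `|1 - (1 + n.+1%:R^-1 : R) ^+ d| <= s.
  by move/cvgrPdist_le : h => /(_ _ s0).
move=> [m _ /(_ m (leqnn _)) hm]; exists m.
by rewrite -lerBlDl; apply: le_trans hm; rewrite distrC ler_norm.
Qed.

Lemma exists_pow_ge (r M : R) : 1 < r -> exists N : nat, M <= r ^+ N.
Proof.
move=> r1; pose h := r - 1; have h0 : 0 < h by rewrite subr_gt0.
exists (Num.truncn (`|M| / h)).+1; set N := _.+1.
have MN : `|M| < N%:R * h by rewrite -ltr_pdivrMr//; exact: truncnS_gt.
have : 1 + N%:R * h <= r ^+ N.
  rewrite -[r](subrK 1) -/h (addrC h); elim: (N) => [|n IH].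
    by rewrite mul0r addr0 expr0.
  rewrite exprS -natr1.
  have : 0 <= n%:R :> R by [].
  have : (1 + h) * (1 + n%:R * h) <= (1 + h) * (1 + h) ^+ n.
    by apply: ler_wpM2l => //; lra.
  nra.
have := ler_norm M; lra.
Qed.

Context {d : nat}.
Variables (P : probability (sample_space R d) R) (G0 : probability 'rV[R]_d R).
Hypotheses (mG0 : mixing G0) (iidP : iid_law P (smu_density G0)).
Let f0 := smu_density G0.
Let mO := @measurable_orthant R d.

Lemma law_orthant : law P orthant = 1.
Proof.
apply: EFin_inj; rewrite -(law_density iidP mO) setIid.
exact: smu_density_mass.
Qed.

Lemma le_law (A B : set 'rV[R]_d) : measurable A -> measurable B -> A `<=` B ->
  law P A <= law P B.
Proof.
move=> mA mB AB; apply: fine_le; rewrite ?fin_num_measure//;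
  try exact: measurable_coordinate.
apply: le_measure; rewrite ?inE; try exact: measurable_coordinate.
by move=> w /=; exact: AB.
Qed.

Definition big_box (M : nat) : set 'rV[R]_d :=
  rect (const_mx M.+1%:R^-1) (const_mx M.+1%:R).

Lemma law_big_box (e : R) : 0 < e -> exists M, 1 - e <= law P (big_box M).
Proof.
move=> e0; pose A M := [set w : sample_space R d | big_box M (w 0%N)].
have mA M : measurable (A M) by apply: measurable_coordinate; exact: measurable_rect.
have mU : measurable (\bigcup_M A M) by exact: bigcup_measurable.
have nA : nondecreasing_seq A.
  move=> m n mn; apply/subsetPset => w /= h i; have := h i.
  rewrite !mxE !in_itv/= => /andP[h1 h2]; apply/andP; split.
    by apply: le_lt_trans h1; rewrite lef_pV2 ?posrE// ler_nat ltnS.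
  by apply: le_trans h2 _; rewrite ler_nat ltnS.
have UE : \bigcup_M A M = [set w : sample_space R d | orthant (w 0%N)].
  apply/seteqP; split => w /=.
    move=> [M _ h] i; have := h i; rewrite !mxE in_itv/= => /andP[+ _].
    by apply: lt_trans; rewrite invr_gt0.
  move=> ow.
  pose S := \sum_i ((w 0%N ord0 i)^-1 + w 0%N ord0 i).
  exists (Num.truncn S) => // i; rewrite !mxE in_itv/=.
  have oi := ow i.
  have Si : (w 0%N ord0 i)^-1 + w 0%N ord0 i <= S.
    rewrite /S (bigD1 i)//= lerDl; apply: sumr_ge0 => k _.
    by apply: addr_ge0; apply: ltW; rewrite ?invr_gt0; exact: ow.
  have := truncnS_gt S; set T := _.+1%:R => ST.
  have iv : 0 < (w 0%N ord0 i)^-1 by rewrite invr_gt0.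
  apply/andP; split; last by lra.
  rewrite -[X in _ < X]invrK ltf_pV2 ?posrE//; lra.
have PU : P (\bigcup_M A M) = 1%E.
  rewrite -[LHS]fineK ?fin_num_measure// UE -[fine _]/(law P orthant).
  by rewrite law_orthant.
have : P \o A @ \oo --> 1%E by rewrite -PU; exact: nondecreasing_cvg_mu.
move=> /fine_cvgP[_ /cvgrPdist_le/(_ _ e0)] [M _ /(_ M (leqnn _)) /= hM].
exists M; rewrite -[law _ _]/(fine (P (A M))).
have := ler_norm (1 - fine (P (A M))); lra.
Qed.

Definition grid_ratio (m : nat) : R := 1 + m.+1%:R^-1.

(** Two properties of a sample that force the maximum likelihood estimators to
converge: the likelihood of f0 never vanishes, and the cells of countably many
grids are visited often enough.  Indexing the grids by natural numbers keeps
the exceptional set a countable union of null sets. *)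
Definition typical (w : nat -> 'rV[R]_d) :=
  (forall i, 0 < f0 (w i)) /\
  (forall k m l N (j : {ffun 'I_d -> 'I_N}), \forall n \near \oo,
    (1 - l.+2%:R^-1) * law P (cell k.+1%:R^-1 (grid_ratio m) j) * n%:R <=
    count_in n (cell k.+1%:R^-1 (grid_ratio m) j) w).

(** The parameters of the grid bound are chosen in the order t, then the
tolerance s for the ratio, the frequencies and the mass of the slab, then the
grid itself; the sample size comes last. *)
Lemma typical_L1_cvg w (G : nat -> probability 'rV[R]_d R) : typical w ->
  (forall n, (0 < n)%N -> mixing (G n) /\ is_MLE n w (smu_density (G n))) ->
  L1_distance (smu_density (G n)) f0 @[n --> \oo] --> 0%E.
Proof.
move=> [w0 wfreq] hG; apply: cvge0_of_le => [n|z z0].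
  by apply: integral_ge0 => x _; rewrite lee_fin.
pose t := z / 8.
have t0 : 0 < t by rewrite divr_gt0.
pose s := Num.min (1 / 2) (Num.min (z / 24) (z ^+ 2 / 192)).
have s0 : 0 < s by rewrite !lt_min !divr_gt0// exprn_gt0.
have s1 : s <= 1 / 2 by rewrite ge_min lexx.
have s2 : s <= z / 24 by rewrite !ge_min lexx orbT.
have s3 : s <= z ^+ 2 / 192 by rewrite !ge_min lexx !orbT.
have [m hm] := exists_ratio_pow_le d s0.
have [M hM] := law_big_box s0.
(* The base point 1 / (2 * (M + 1)) leaves room for the shift by the ratio,
   which is at most 2. *)
pose k := (2 * M).+1.
pose a : R := k.+1%:R^-1.
have a0 : 0 < a by rewrite invr_gt0.
pose r := grid_ratio m.
have r1 : 1 < r by rewrite /r /grid_ratio ltrDl invr_gt0.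
have r2 : r <= 2 by rewrite /r /grid_ratio [leRHS]mulr2n lerD2l invf_le1// ler1n.
have [N hN] := exists_pow_ge (2 * M.+1%:R ^+ 2) r1.
have [l hl] : exists l : nat, (1 - l.+2%:R^-1)^-1 <= 1 + s.
  exists (Num.truncn s^-1); have := truncnS_gt s^-1; set T := Num.truncn _ => sT.
  have T0 : 0 < T.+1%:R :> R by [].
  have -> : (1 - T.+2%:R^-1)^-1 = 1 + T.+1%:R^-1 :> R.
    rewrite -[T.+2%:R]natr1; move: (T.+1%:R) T0 => y y0; field.
    have y1 : 0 < y + 1 by lra.
    by rewrite ?addrK !gt_eqF.
  by rewrite lerD2l -[leRHS]invrK lef_pV2 ?posrE ?invr_gt0// ltW.
have e01 : 0 < (l.+2%:R^-1 : R) < 1 by rewrite invr_gt0 invf_lt1 ?ltr0n//= ltr1n.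
have slab_ge : 1 - s <= law P (@slab R d N (a * r) r).
  apply: le_trans hM _; apply: le_law; [exact: measurable_rect|exact: measurable_rect|].
  have M0 : 0 < M.+1%:R :> R by [].
  have aE : a * (2 * M.+1%:R) = 1.
    by rewrite -natrM mulnS add2n mulVf// pnatr_eq0.
  have M1 : M.+1%:R^-1 * M.+1%:R = 1 :> R by rewrite mulVf// gt_eqF.
  move=> x h i; have := h i; rewrite !mxE !in_itv/= => /andP[h1 h2].
  have aM : a * 2 = M.+1%:R^-1.
    by apply: (mulIf (lt0r_neq0 M0)); rewrite M1 -mulrA.
  apply/andP; split.
    by apply: le_lt_trans h1; rewrite -aM ler_pM2l.
  apply: le_trans h2 _.
  have : M.+1%:R <= a * (2 * M.+1%:R ^+ 2).
    have -> : a * (2 * M.+1%:R ^+ 2) = a * (2 * M.+1%:R) * M.+1%:R.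
      by rewrite expr2 !mulrA.
    by rewrite aE mul1r.
  move/le_trans; apply; rewrite -mulrA ler_pM2l//.
  apply: le_trans hN _; rewrite ler_peMl ?(ltW r1)// exprn_ge0//.
  by apply: ltW; exact: lt_trans r1.
have : \forall n \near \oo, (0 < n)%N /\ forall j : {ffun 'I_d -> 'I_N},
    (1 - l.+2%:R^-1) * law P (cell a r j) * n%:R <= count_in n (cell a r j) w.
  near=> n; split; first by near: n; exists 1%N.
  by near: n; apply: filter_forall => j; exact: wfreq.
apply: filterS => n [n0 fn].
have [mG mle] := hG _ n0.
have [fX score] := MLE_score mG mG0 mle (fun i => w0 i).
have lawE B := law_density iidP (B := B).
have := grid_bound mG mG0 lawE n0 a0 r1 e01 fX score fn t0 erefl.
move/le_trans; apply; rewrite lee_fin.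
set L := law P _ in slab_ge *; set i := (1 - _)^-1 in hl *.
set u := r^-1 ^+ d; set q := r ^+ d.
have r0 : 0 < r by exact: lt_trans r1.
have uq : u * q = 1 by rewrite -exprMn mulVf ?expr1n// gt_eqF.
have q1 : q <= 1 + s := hm.
have u0 : 0 < u by rewrite exprn_gt0// invr_gt0.
have u1 : 1 - s <= u by nra.
have uL : 1 - 2 * s <= u * L by nra.
have uuL : 1 - 3 * s <= u ^+ 2 * L by rewrite expr2 -mulrA; nra.
have ti : t^-1 * (6 * s) <= z / 4.
  rewrite mulrC ler_pdivrMr// /t; move: s3; rewrite expr2; lra.
have tB : t^-1 * (i - 2 * (u * L) + q) <= t^-1 * (6 * s).
  by rewrite ler_pM2l ?invr_gt0//; lra.
have tq : t * q <= z / 4 by rewrite /t; nra.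
lra.
Unshelve. all: by end_near.
Qed.

Lemma ae_typical : {ae P, forall w, typical w}.
Proof.
have h1 : {ae P, forall w : sample_space R d, forall i, 0 < f0 (w i)}.
  apply: ae_foralln => i; pose Z := f0 @^-1` [set 0].
  have mZ : measurable Z.
    by rewrite -[Z]setTI; exact: measurable_smu_density.
  exists [set w : sample_space R d | Z (w i)]; split.
  - exact: measurable_coordinate.
  - apply: etrans (law_coordinate iidP i mZ) _.
    rewrite -(law_density iidP)// integral0_eq//.
    by move=> x [_ Zx]; rewrite -[smu_density _ _]/(f0 x) Zx.
  - move=> w /= wi; apply/eqP/negPn/negP => fw; apply: wi.
    by rewrite lt_neqAle eq_sym fw smu_density_ge0.
have h2 : {ae P, forall w : sample_space R d, forall k m l N (j : {ffun 'I_d -> 'I_N}),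
  \forall n \near \oo,
    (1 - l.+2%:R^-1) * law P (cell k.+1%:R^-1 (grid_ratio m) j) * n%:R <=
    count_in n (cell k.+1%:R^-1 (grid_ratio m) j) w}.
  apply: ae_foralln => k; apply: ae_foralln => m; apply: ae_foralln => l.
  apply: ae_foralln => N.
  pose C (i : nat) : set 'rV[R]_d := if @unpickle {ffun 'I_d -> 'I_N} i is Some j
    then cell k.+1%:R^-1 (grid_ratio m) j else set0.
  have mC i : measurable (C i).
    by rewrite /C; case: unpickle => // j; exact: measurable_rect.
  have e01 : 0 < (l.+2%:R^-1 : R) < 1 by rewrite invr_gt0 invf_lt1 ?ltr0n//= ltr1n.
  have := ae_foralln (fun i => ae_count_in_ge iidP (mC i) e01).
  by apply: filterS => w hw j; have := hw (pickle j); rewrite /C pickleK.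
by apply: filterS2 h1 h2 => w.
Qed.

End strong_L1_consistency.

(** * Hellinger distance and masses of sets *)

Section L1_consequences.
Context {R : realType} {d : nat}.
Implicit Types (G : probability 'rV[R]_d R).

Lemma sqr_sqrtB_le (a b : R) : 0 <= a -> 0 <= b ->
  (Num.sqrt a - Num.sqrt b) ^+ 2 <= `|a - b|.
Proof.
move=> a0 b0; rewrite -{2}(sqr_sqrtr a0) -{2}(sqr_sqrtr b0) subr_sqr normrM.
rewrite -normr_id -real_normK ?num_real// expr2 normr_id ler_wpM2l//.
have := sqrtr_ge0 a; have := sqrtr_ge0 b => u0 v0.
by rewrite [leRHS]ger0_norm ?addr_ge0// ler_norml; apply/andP; split; lra.
Qed.

Lemma hellinger_cvg (G : nat -> probability 'rV[R]_d R) G0 :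
  L1_distance (smu_density (G n)) (smu_density G0) @[n --> \oo] --> 0%E ->
  hellinger (smu_density (G n)) (smu_density G0) @[n --> \oo] --> 0%E.
Proof.
move=> h; apply: cvge0_of_le => [n|e e0]; first exact: sqrte_ge0.
have e2 : 0 < 2 * e ^+ 2 by rewrite mulr_gt0// exprn_gt0.
have : \forall n \near \oo,
    (L1_distance (smu_density (G n)) (smu_density G0) <= (2 * e ^+ 2)%:E)%E.
  move/fine_cvgP : h => [h1 /cvgrPdist_le/(_ _ e2) h2].
  near=> n; rewrite -[leLHS]fineK; last by near: n.
  rewrite lee_fin; apply: le_trans (ler_norm _) _.
  by rewrite -normrN -[- fine _]sub0r; near: n.
apply: filterS => n hn; rewrite -[e%:E]gee0_abs ?lee_fin ?(ltW e0)// -sqrte_sqr.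
rewrite /hellinger lee_sqrt ?sqre_ge0//.
apply: (@le_trans _ _ (2^-1%:E * (2 * e ^+ 2)%:E)%E); last first.
  by rewrite -EFinM mulrA mulVf// mul1r EFin_expe.
apply: lee_wpmul2l; first by rewrite lee_fin.
apply: le_trans hn; apply: ge0_le_integral.
- exact: measurable_orthant.
- by move=> x _; rewrite lee_fin sqr_ge0.
- apply/measurable_EFinP; apply: measurable_funTS; apply: measurable_funX.
  have ms : measurable_fun [set: R] Num.sqrt.
    by apply: continuous_measurable_fun; exact: sqrt_continuous.
  by apply: measurable_funB; apply: (measurableT_comp ms);
    exact: measurable_smu_density.
- apply/measurable_EFinP; apply: measurable_funTS; apply: measurableT_comp => //.
  by apply: measurable_funB; exact: measurable_smu_density.
- by move=> x _; rewrite lee_fin sqr_sqrtB_le// smu_density_ge0.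
Unshelve. all: by end_near. Qed.

Lemma smu_density_integrable G : mixing G ->
  leb.-integrable setT (EFin \o smu_density G).
Proof.
move=> mG; apply/integrableP; split.
  by apply/measurable_EFinP; exact: measurable_smu_density.
under eq_integral do rewrite /= ger0_norm ?smu_density_ge0//.
rewrite (_ : integral _ _ _ = 1%E) ?ltry// -(smu_density_mass mG).
rewrite [RHS]integral_mkcond; apply: eq_integral => x _; rewrite patchE.
by case: ifPn => // /negP xo; rewrite smu_density_eq0// => /mem_set.
Qed.

Lemma smu_mass_cvg (G : nat -> probability 'rV[R]_d R) G0 (B : set 'rV[R]_d) :
  (forall n, (0 < n)%N -> mixing (G n)) -> mixing G0 -> measurable B ->
  L1_distance (smu_density (G n)) (smu_density G0) @[n --> \oo] --> 0%E ->
  \int[leb]_(x in B) smu_density (G n) x @[n --> \oo] -->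
  \int[leb]_(x in B) smu_density G0 x.
Proof.
move=> mG mG0 mB /fine_cvgP[fin /cvgrPdist_le h].
apply/cvgrPdist_le => e e0; have {}h := h _ e0.
near=> n.
have n0 : (0 < n)%N by near: n; exists 1%N.
have fn : L1_distance (smu_density (G n)) (smu_density G0) \is a fin_num by near: n.
have : fine (L1_distance (smu_density (G n)) (smu_density G0)) <= e.
  apply: le_trans (ler_norm _) _.
  by rewrite -normrN -[- fine _]sub0r; near: n.
apply: le_trans; rewrite distrC.
have iB K : mixing K -> leb.-integrable B (EFin \o smu_density K).
  by move=> mK; apply: integrableS (smu_density_integrable mK).
rewrite -RintegralB//; [|exact/iB/mG|exact: iB].
have iD : leb.-integrable setT
    (EFin \o (smu_density (G n) \- smu_density G0)).
  have := integrableB measurableT (smu_density_integrable (mG _ n0))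
    (smu_density_integrable mG0).
  by apply: eq_integrable => // x _ /=; rewrite EFinB.
have iDB := integrableS measurableT mB (@subsetT _ B) iD.
apply: le_trans (le_normr_Rintegral mB iDB) _.
rewrite /Rintegral; apply: fine_le => //.
  have := integrable_fin_num mB (integrable_abse iDB).
  by [].
apply: (@le_trans _ _ (\int[leb]_x `|smu_density (G n) x - smu_density G0 x|%:E)%E).
  apply: ge0_subset_integral => //.
  apply/measurable_EFinP; apply: measurableT_comp => //.
  by apply: measurable_funB; exact: measurable_smu_density.
rewrite le_eqVlt; apply/orP; left; apply/eqP.
rewrite /L1_distance [RHS]integral_mkcond; apply: eq_integral => x _.
rewrite patchE; case: ifPn => // /negP xo.
by rewrite !smu_density_eq0 ?subrr ?normr0// => /mem_set.
Unshelve. all: by end_near. Qed.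

End L1_consequences.

(** * Pointwise convergence *)

Section pointwise_consistency.
Context {R : realType} {d : nat}.
Implicit Types (G : probability 'rV[R]_d R) (x y v : 'rV[R]_d).

Definition diag_shift x (s : R) : 'rV[R]_d := \row_i (x ord0 i + s).

(** For a decreasing function, this one-dimensional condition along the diagonal
is equivalent to continuity at x, and it is what the sandwich between averages
over neighbouring boxes consumes. *)
Definition shift_accessible G x := forall e : R, 0 < e -> exists s : R,
  [/\ 0 < s, orthant (diag_shift x (- s)),
      smu_density G (diag_shift x (- s)) <= smu_density G x + e &
      smu_density G x - e <= smu_density G (diag_shift x s)].

Lemma smu_rect_bounds G x y : mixing G -> orthant x ->
  (forall i, x ord0 i < y ord0 i) ->
  let c := \prod_(i < d) (y ord0 i - x ord0 i) in
  smu_density G y * c <= \int[leb]_(z in rect x y) smu_density G z /\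
  \int[leb]_(z in rect x y) smu_density G z <= smu_density G x * c.
Proof.
move=> mG ox xy c.
have mr : measurable (rect x y) by exact: measurable_rect.
have cE : leb (rect x y) = c%:E by rewrite leb_rect// => i; exact/ltW.
have iB : leb.-integrable (rect x y) (EFin \o smu_density G).
  exact: integrableS (smu_density_integrable mG).
have iC (k : R) : leb.-integrable (rect x y) (EFin \o cst k).
  by apply: (measurable_bounded_integrable (A := rect x y)) => //;
    [rewrite [X in (X < _)%E]cE ltry|exact: bounded_cst].
have int_cst (k : R) : \int[leb]_(z in rect x y) (cst k z) = k * c.
  by rewrite Rintegral_cst// [X in _ * fine X]cE.
split.
  rewrite -int_cst; apply: le_Rintegral => // z zr.
  apply: smu_density_anti => i; have := zr i; rewrite in_itv/= => /andP[h1 h2] //.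
  exact: lt_trans h1.
rewrite -int_cst; apply: le_Rintegral => // z zr.
apply: smu_density_anti => // i; have := zr i.
by rewrite in_itv/= => /andP[/ltW].
Qed.

(** The value at x of a decreasing density lies between its averages over the
boxes from x to z and from y to x, and these averages converge. *)
Lemma smu_density_pointwise_cvg (G : nat -> probability 'rV[R]_d R) G0 x :
  (forall n, (0 < n)%N -> mixing (G n)) -> mixing G0 ->
  L1_distance (smu_density (G n)) (smu_density G0) @[n --> \oo] --> 0%E ->
  orthant x -> shift_accessible G0 x ->
  smu_density (G n) x @[n --> \oo] --> smu_density G0 x.
Proof.
move=> mG mG0 hL ox acc; apply/cvgrPdist_le => e e0.
have e2 : 0 < e / 2 by rewrite divr_gt0.
have [s [s0 oy fy fz]] := acc _ e2.
set y := diag_shift x (- s) in oy fy *; set z := diag_shift x s in fz *.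
have yx i : y ord0 i < x ord0 i by rewrite mxE ltrBlDr ltrDl.
have xz i : x ord0 i < z ord0 i by rewrite mxE ltrDl.
pose c := s ^+ d.
have c0 : 0 < c by rewrite exprn_gt0.
have prodc (u v : 'rV[R]_d) : (forall i, v ord0 i - u ord0 i = s) ->
    \prod_(i < d) (v ord0 i - u ord0 i) = c.
  by move=> uv; rewrite (eq_bigr (fun=> s))// prodr_const card_ord.
have cyx : \prod_(i < d) (x ord0 i - y ord0 i) = c.
  by apply: prodc => i; rewrite mxE opprD opprK addrA subrr add0r.
have cxz : \prod_(i < d) (z ord0 i - x ord0 i) = c.
  by apply: prodc => i; rewrite mxE addrAC subrr add0r.
have ce : 0 < c * (e / 2) by rewrite mulr_gt0.
have /cvgrPdist_le/(_ _ ce) h1 := smu_mass_cvg mG mG0 (measurable_rect y x) hL.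
have /cvgrPdist_le/(_ _ ce) h2 := smu_mass_cvg mG mG0 (measurable_rect x z) hL.
near=> n.
have n0 : (0 < n)%N by near: n; exists 1%N.
have : `|\int[leb]_(t in rect y x) smu_density G0 t -
    \int[leb]_(t in rect y x) smu_density (G n) t| <= c * (e / 2) by near: n.
have : `|\int[leb]_(t in rect x z) smu_density G0 t -
    \int[leb]_(t in rect x z) smu_density (G n) t| <= c * (e / 2) by near: n.
have [+ _] := smu_rect_bounds (mG _ n0) oy yx.
have [_ +] := smu_rect_bounds (mG _ n0) ox xz.
have [_ +] := smu_rect_bounds mG0 oy yx.
have [+ _] := smu_rect_bounds mG0 ox xz.
rewrite cyx cxz => g1 g2 g3 g4.
rewrite !ler_norml => /andP[_ k1] /andP[k2 _].
have cy := ler_wpM2r (ltW c0) fy; have cz := ler_wpM2r (ltW c0) fz.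
rewrite mulrDl in cy; rewrite mulrBl in cz.
apply/andP; split.
  by rewrite -(ler_pM2r c0) mulNr mulrBl; lra.
by rewrite -(ler_pM2r c0) mulrBl; lra.
Unshelve. all: by end_near. Qed.

Lemma continuous_shift_accessible G x : orthant x ->
  {for x, continuous (smu_density G)} -> shift_accessible G x.
Proof.
move=> ox cf e e0.
move/cvgrPdist_lt/(_ _ e0) : cf => /nbhs_ballP[r /= r0 rx].
pose m := \big[Num.min/r]_(i < d) x ord0 i.
have m0 : 0 < m.
  by rewrite /m; elim/big_ind : _ => // a b a0 b0; rewrite lt_min a0.
have mr : m <= r by rewrite /m; exact: bigmin_le_id.
have mx i : m <= x ord0 i by rewrite /m; exact: bigmin_le_cond.
pose s := m / 2.
have s0 : 0 < s by rewrite divr_gt0.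
have sm : s < m by rewrite /s; lra.
have near_x (t : R) : `|t| < r -> `|smu_density G x - smu_density G (diag_shift x t)| < e.
  move=> tr; apply: rx; split => // i j; rewrite (ord1 i) /ball/= mxE.
  by rewrite opprD addrA subrr add0r normrN.
have := near_x s; have := near_x (- s).
rewrite normrN gtr0_norm// (lt_le_trans sm mr) => /(_ isT) h1 /(_ isT) h2.
exists s; split=> //.
- by move=> i; rewrite mxE subr_gt0 (lt_le_trans sm).
- by move: h1; rewrite ltr_norml => /andP[h _]; lra.
- by move: h2; rewrite ltr_norml => /andP[_ h]; lra.
Qed.

(** The kernel jumps in its first argument only across the hyperplanes through
v, and in the orthant across the coordinate hyperplanes. *)
Lemma smu_kernel_shift_near x v (s : nat -> R) : orthant x ->
  (forall i, v ord0 i != x ord0 i) -> s @ \oo --> (0 : R) ->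
  \forall k \near \oo, smu_kernel (diag_shift x (s k)) v = smu_kernel x v.
Proof.
move=> ox vx s0.
have small (e : R) : 0 < e -> \forall k \near \oo, `|s k| < e.
  by move=> e0; move/cvgrPdist_lt : s0 => /(_ _ e0); apply: filterS => k;
    rewrite sub0r normrN.
have coord i : \forall k \near \oo, 0 < x ord0 i + s k /\
    (x ord0 i + s k <= v ord0 i) = (x ord0 i <= v ord0 i).
  have oi := ox i.
  have di : 0 < `|v ord0 i - x ord0 i| by rewrite normr_gt0 subr_eq0.
  apply: filterS2 (small _ oi) (small _ di) => k.
  rewrite !ltr_norml => /andP[h1 h2]; have := vx i.
  rewrite neq_lt => /orP[lt|lt].
    rewrite ltr0_norm ?subr_lt0// => /andP[h3 h4]; split; first by lra.
    by apply/idP/idP; lra.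
  rewrite gtr0_norm ?subr_gt0// => /andP[h3 h4]; split; first by lra.
  by apply/idP/idP; lra.
have : \forall k \near \oo, forall i, 0 < x ord0 i + s k /\
    (x ord0 i + s k <= v ord0 i) = (x ord0 i <= v ord0 i).
  by apply: filter_forall => i; exact: coord.
apply: filterS => k hk.
have [xv|xv] := pselect (forall i, 0 < x ord0 i <= v ord0 i).
  have ov : orthant v by move=> i; have /andP[/lt_le_trans] := xv i; exact.
  rewrite !smu_kernelE// => i; rewrite mxE; have [-> ->] := hk i.
  by have /andP[_ ->] := xv i.
rewrite !smu_kernel_eq0// => h; apply: xv => i; rewrite ox/=.
by have := h i; rewrite mxE; have [_ ->] := hk i => /andP[].
Qed.

Lemma smu_density_shift_cvg G x (s : nat -> R) (b : R) : orthant x ->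
  {ae G, forall v, forall i, v ord0 i != x ord0 i} ->
  orthant (diag_shift x (- b)) -> (forall k, `|s k| <= b) -> s @ \oo --> (0 : R) ->
  smu_density G (diag_shift x (s k)) @[k --> \oo] --> smu_density G x.
Proof.
move=> ox vx ob sb s0; set y := diag_shift x (- b) in ob.
have yk k i : y ord0 i <= diag_shift x (s k) ord0 i.
  by rewrite !mxE lerD2l; have := sb k; rewrite ler_norml => /andP[].
have ok k : orthant (diag_shift x (s k)).
  by move=> i; apply: lt_le_trans (yk k i); exact: ob.
have [] := @dominated_convergence _ _ _ G setT measurableT
  (fun k v => (smu_kernel (diag_shift x (s k)) v)%:E)
  (fun v => (smu_kernel x v)%:E) (cst (vol y)^-1%:E).
- by move=> k; apply/measurable_EFinP; exact: measurable_smu_kernelr.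
- by apply/measurable_EFinP; exact: measurable_smu_kernelr.
- move: vx; apply: filterS => v vx _.
  apply: cvg_near_cst.
  by have := smu_kernel_shift_near ox vx s0; apply: filterS => k ->.
- exact: finite_measure_integrable_cst.
- apply: aeW => v k _; rewrite lee_fin ger0_norm ?smu_kernel_ge0//.
  by apply: le_trans (smu_kernel_le _ ob); exact: smu_kernel_anti.
move=> _ _; rewrite -smu_densityE => /fine_cvgP[_]; apply: cvg_trans.
by apply: near_eq_cvg; apply: nearW => k /=; rewrite -smu_densityE.
Qed.

Lemma no_atom_shift_accessible G x : orthant x ->
  {ae G, forall v, forall i, v ord0 i != x ord0 i} -> shift_accessible G x.
Proof.
move=> ox vx e e0.
pose m := \big[Num.min/1]_(i < d) x ord0 i.
have m0 : 0 < m.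
  by rewrite /m; elim/big_ind : _ => // a b a0 b0; rewrite lt_min a0.
have mx i : m <= x ord0 i by rewrite /m; exact: bigmin_le_cond.
pose b := m / 2.
have b0 : 0 < b by rewrite divr_gt0.
have bm : b < m by rewrite /b; lra.
have ob : orthant (diag_shift x (- b)).
  by move=> i; rewrite mxE subr_gt0 (lt_le_trans bm).
pose s (k : nat) : R := b * k.+1%:R^-1.
have s_gt0 k : 0 < s k by rewrite mulr_gt0 ?invr_gt0.
have sb k : s k <= b by rewrite ler_piMr ?(ltW b0)// invf_le1// ler1n.
have s0 : s @ \oo --> (0 : R).
  by rewrite -[X in _ --> X](mulr0 b); apply: cvgM; [exact: cvg_cst|exact: cvg_harmonic].
have s0' : (fun k => - s k) @ \oo --> (0 : R).
  by rewrite -[X in _ --> X]oppr0; exact: cvgN.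
have h1 : \forall k \near \oo,
    `|smu_density G x - smu_density G (diag_shift x (s k))| <= e.
  have sb' k : `|s k| <= b by rewrite gtr0_norm.
  by have /cvgrPdist_le := smu_density_shift_cvg ox vx ob sb' s0; exact.
have h2 : \forall k \near \oo,
    `|smu_density G x - smu_density G (diag_shift x (- s k))| <= e.
  have sb' k : `|- s k| <= b by rewrite normrN gtr0_norm.
  by have /cvgrPdist_le := smu_density_shift_cvg ox vx ob sb' s0'; exact.
have [k _ /(_ k (leqnn k)) [{}h1 {}h2]] := filterI h1 h2.
exists (s k); split => //.
- by move=> i; rewrite mxE subr_gt0 (le_lt_trans (sb k))// (lt_le_trans bm).
- by move: h2; rewrite ler_norml => /andP[h _]; lra.
- by move: h1; rewrite ler_norml => /andP[_ h]; lra.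
Qed.

End pointwise_consistency.

(** * Coordinate hyperplanes *)

Section hyperplanes.
Context {R : realType}.

Lemma measurable_hyperplane d (i : 'I_d) (c : R) :
  measurable [set x : 'rV[R]_d | x ord0 i = c].
Proof.
rewrite -[X in measurable X]setTI.
exact: (measurable_coord_rV i measurableT (measurable_set1 c)).
Qed.

Lemma lebesgue_rV_hyperplane d (i : 'I_d) (c : R) :
  lebesgue_rV d [set x : 'rV[R]_d | x ord0 i = c] = 0%E.
Proof.
elim: d i => [[]//|d IH] i; rewrite /= /lebesgue_cons /pushforward.
case: (unliftP ord0 i) => [j ->|->].
  rewrite (_ : _ @^-1` _ = setT `*` [set x : 'rV[R]_d | x ord0 j = c]).
    rewrite product_measure2E//; last exact: measurable_hyperplane.
    by rewrite [X in (_ * X)%E]IH mule0.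
  by apply/seteqP; split => -[t x] /=; rewrite mxE liftK //= => -[].
rewrite (_ : _ @^-1` _ = [set c] `*` setT).
  by rewrite product_measure2E//= lebesgue_measure_set1 mul0e.
by apply/seteqP; split => -[t x] /=; rewrite mxE unlift_none //= => -[].
Qed.

Context {d : nat}.
Implicit Types (G : probability 'rV[R]_d R) (x v : 'rV[R]_d).

(** Exchange the order of integration in the product of Lebesgue measure and G:
for fixed v, the points x that share a coordinate with v form a null set. *)
Lemma ae_no_atom G : {ae leb, forall x, {ae G, forall v, forall i, v ord0 i != x ord0 i}}.
Proof.
suff h i : {ae leb, forall x, {ae G, forall v, v ord0 i != x ord0 i}}.
  have : {ae leb, forall x, forall i, {ae G, forall v, v ord0 i != x ord0 i}}.
    by apply: filter_forall => i; exact: h.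
  by apply: filterS => x hx; apply: filter_forall => i; exact: hx.
pose D := [set p : 'rV[R]_d * 'rV[R]_d | p.1 ord0 i = p.2 ord0 i].
have mD : measurable D.
  rewrite -[D]setTI; have : measurable_fun setT
      (fun p : 'rV[R]_d * 'rV[R]_d => p.1 ord0 i - p.2 ord0 i).
    apply: measurable_funB.
      exact: (measurableT_comp (measurable_coord_rV i) measurable_fst).
    exact: (measurableT_comp (measurable_coord_rV i) measurable_snd).
  move=> /(_ measurableT _ (measurable_set1 0)).
  rewrite (_ : _ @^-1` _ = D)//.
  by apply/seteqP; split => p /= => [/subr0_eq//|/eqP]; rewrite -subr_eq0 => /eqP.
pose h (p : 'rV[R]_d * 'rV[R]_d) := (\1_D p : R)%:E.
have mh : measurable_fun setT h by apply/measurable_EFinP; exact: measurable_indic.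
have h0 p : (0 <= h p)%E by rewrite lee_fin.
have xE x : (\int[G]_v h (x, v) = G [set v | v ord0 i = x ord0 i])%E.
  have := integral_indic G measurableT (measurable_hyperplane i (x ord0 i)).
  rewrite setIT => <-.
  apply: eq_integral => v _; rewrite /h !indicE; congr ((nat_of_bool _)%:R%:E).
  by apply/idP/idP; rewrite !inE.
have : (\int[leb]_x \int[G]_v h (x, v) = 0)%E.
  rewrite (@fubini_tonelli _ _ _ _ _ leb G h mh h0) integral0_eq// => v _.
  transitivity (leb [set x | x ord0 i = v ord0 i]); last exact: lebesgue_rV_hyperplane.
  have := integral_indic leb measurableT (measurable_hyperplane i (v ord0 i)).
  rewrite setIT => <-.
  by apply: eq_integral => x _; rewrite /h !indicE.
have mF : measurable_fun setT (fun x => \int[G]_v h (x, v))%E.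
  by apply: measurable_fun_fubini_tonelli_F.
rewrite (eq_integral (fun x => `|\int[G]_v h (x, v)|)%E); last first.
  by move=> x _; rewrite gee0_abs// integral_ge0.
move/(ae_eq_integral_abs leb measurableT mF); apply: filterS => x /(_ Logic.I).
rewrite xE => Gx; exists [set v : 'rV[R]_d | v ord0 i = x ord0 i]; split => //.
  exact: measurable_hyperplane.
by move=> v /= /negP; rewrite negbK => /eqP.
Qed.

End hyperplanes.

(** * Hat functions *)

Section hat_functions.
Context {R : realType}.
Implicit Types (h t : R) (j N : nat).

(** The piecewise linear hat function with nodes j h, (j+1) h and (j+2) h,
multiplied by (j+1) h / t.  The function t |-> min 1 (s / t) is min t s divided
by t, and a hat function is a second difference of the functions min t s.  The
hat functions with weights (j+1) h interpolate t at the nodes, hence sum to t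
on the range that the nodes cover, and division by t gives the sum 1. *)
Definition hat j h t : R := j.+1%:R *
  (2 * Num.min 1 (j.+1%:R * h / t) - Num.min 1 (j%:R * h / t)
   - Num.min 1 (j.+2%:R * h / t)).

(** This is 1 up to N h and vanishes beyond (N+1) h. *)
Definition ramp N h t : R :=
  N.+1%:R * Num.min 1 (N%:R * h / t) - N%:R * Num.min 1 (N.+1%:R * h / t).

Lemma hat_ramp j h t : hat j h t = ramp j.+1 h t - ramp j h t.
Proof. by rewrite /hat /ramp -(natr1 j.+1) -(natr1 j); ring. Qed.

Lemma sum_hat N h t : \sum_(j < N) hat j h t = ramp N h t.
Proof.
rewrite -(big_mkord xpredT (fun j => hat j h t)).
under eq_bigr do rewrite hat_ramp.
rewrite telescope_sumr// [ramp 0 h t]/ramp !mul0r minEle ler10 mulr0.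
by rewrite !subr0.
Qed.

Lemma hat_ge0 j h t : 0 < h -> 0 < t -> 0 <= hat j h t.
Proof.
move=> h0 t0; rewrite /hat mulr_ge0// -!(mulrA _ h).
have z0 : 0 < h / t by rewrite divr_gt0.
have y0 : 0 <= j%:R * (h / t) by rewrite mulr_ge0// ltW.
have -> : j.+2%:R * (h / t) = j%:R * (h / t) + h / t + h / t.
  by rewrite -(natr1 j.+1) -(natr1 j); ring.
have -> : j.+1%:R * (h / t) = j%:R * (h / t) + h / t by rewrite -(natr1 j); ring.
move: (h / t) (j%:R * _) z0 y0 => z y z0 y0.
case: (leP 1 (y + z)); case: (leP 1 y); case: (leP 1 (y + z + z)); lra.
Qed.

Lemma hat_support j h t : 0 < h -> 0 < t -> hat j h t != 0 ->
  `|t - j.+1%:R * h| < h.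
Proof.
move=> h0 t0; rewrite /hat mulf_eq0 negb_or => /andP[_].
have -> : j.+2%:R * h = j%:R * h + h + h by rewrite -(natr1 j.+1) -(natr1 j); ring.
have -> : j.+1%:R * h = j%:R * h + h by rewrite -(natr1 j); ring.
rewrite ltr_norml.
have y0 : 0 <= j%:R * h by rewrite mulr_ge0// ltW.
move: (j%:R * h) y0 => y y0 nz.
apply/andP; split; rewrite ltNge; apply/negP => ht; move/eqP : nz; apply.
  by rewrite !min_l ?ler_pdivlMr//; lra.
rewrite !min_r ?ler_pdivrMr//; [|lra..].
by field; rewrite gt_eqF.
Qed.

Lemma ramp_le1 N h t : 0 < h -> 0 < t -> ramp N h t <= 1.
Proof.
move=> h0 t0; rewrite /ramp -!mulrA -(natr1 N).
have z0 : 0 < h / t by rewrite divr_gt0.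
have n0 : 0 <= N%:R :> R by [].
move: (h / t) (N%:R : R) z0 n0 => z n z0 n0.
case: (leP 1 (n * z)); case: (leP 1 ((n + 1) * z)) => h1 h2; nra.
Qed.

Lemma ramp_eq1 N h t : 0 < h -> 0 < t -> t <= N%:R * h -> ramp N h t = 1.
Proof.
move=> h0 t0 tN; rewrite /ramp -(natr1 N) !min_l ?ler_pdivlMr//; lra.
Qed.

End hat_functions.

(** * Functions whose integrals converge *)

Section weak_consistency.
Context {R : realType} {d : nat}.
Variables (G : nat -> probability 'rV[R]_d R) (G0 : probability 'rV[R]_d R).
Hypotheses (mG : forall n, (0 < n)%N -> mixing (G n)) (mG0 : mixing G0).
Hypothesis hL : L1_distance (smu_density (G n)) (smu_density G0) @[n --> \oo] --> 0%E.
Implicit Types (T phi : 'rV[R]_d -> R) (v a : 'rV[R]_d).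
Let mO := @measurable_orthant R d.

Definition regular T := measurable_fun orthant T /\
  exists C, forall v, orthant v -> `|T v| <= C.

Definition integral_cvg T :=
  \int[G n]_(v in orthant) T v @[n --> \oo] --> \int[G0]_(v in orthant) T v.

Lemma regular_integrable (Q : probability 'rV[R]_d R) T : regular T ->
  Q.-integrable orthant (EFin \o T).
Proof.
move=> [mT [C hC]]; apply: measurable_bounded_integrable => //.
  by rewrite (le_lt_trans (probability_le1 _ _)) ?ltry.
exists C; split; first exact: num_real.
by move=> M CM v ov; apply: (le_trans (hC v ov)); exact: ltW.
Qed.

Lemma regular_cst (k : R) : regular (cst k).
Proof. by split => //; exists `|k|. Qed.

Lemma regularD T1 T2 : regular T1 -> regular T2 -> regular (T1 \+ T2).
Proof.
move=> [m1 [C1 h1]] [m2 [C2 h2]]; split; first exact: measurable_funD.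
exists (C1 + C2) => v ov; apply: le_trans (ler_normD _ _) _.
by rewrite lerD ?h1 ?h2.
Qed.

Lemma regularZ (k : R) T : regular T -> regular (fun v => k * T v).
Proof.
move=> [mT [C hC]]; split; first exact: measurable_funM.
by exists (`|k| * C) => v ov; rewrite normrM ler_wpM2l// hC.
Qed.

Lemma regular_sum (I : finType) (T : I -> 'rV[R]_d -> R) :
  (forall i, regular (T i)) -> regular (fun v => \sum_i T i v).
Proof.
move=> h; rewrite (_ : (fun v => _) = \sum_i T i).
  elim/big_ind : _ => [|f g|i _]; [exact: (regular_cst 0)|exact: regularD|exact: h].
by apply/funext => v; rewrite fct_sumE.
Qed.

Lemma integral_cvg_sum (I : finType) (k : I -> R) (T : I -> 'rV[R]_d -> R) :
  (forall i, regular (T i)) -> (forall i, integral_cvg (T i)) ->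
  integral_cvg (fun v => \sum_i k i * T i v).
Proof.
move=> rT cT; rewrite /integral_cvg.
have E (Q : probability 'rV[R]_d R) : \int[Q]_(v in orthant) (\sum_i k i * T i v) =
    \sum_i k i * \int[Q]_(v in orthant) T i v.
  have iT i : Q.-integrable orthant (EFin \o (fun v => k i * T i v)).
    by apply: regular_integrable; exact: regularZ.
  apply: EFin_inj; rewrite -sumEFin /Rintegral fineK; last first.
    apply: integrable_fin_num => //; under eq_fun do rewrite -sumEFin.
    by apply: integrable_sum => // i _; exact: iT.
  under eq_integral do rewrite -sumEFin.
  rewrite integral_sum//; apply: eq_bigr => i _.
  rewrite -(fineK (integrable_fin_num mO (iT i))) -[fine _]/(Rintegral _ _ _).
  by rewrite RintegralZl//; exact: regular_integrable.
rewrite E; under eq_cvg do rewrite E.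
by apply: cvg_big => [|i _]; [exact: add_continuous|apply: cvgM; [exact: cvg_cst|exact: cT]].
Qed.

Lemma integral_cvg_box_ratio a : (forall i, 0 <= a ord0 i) ->
  regular (box_ratio a) /\ integral_cvg (box_ratio a).
Proof.
move=> a0; split.
  split.
    apply: measurable_prod => i _; apply: measurable_minr => //.
    rewrite (_ : (fun v => _) = (fun v => a ord0 i * (v ord0 i)^-1))//.
    apply: (eq_measurable_fun (fun v : 'rV[R]_d => a ord0 i * (v ord0 i) `^ (-1))).
      by move=> v /set_mem ov; rewrite powR_inv1// ltW.
    apply: measurable_funTS; apply: measurable_funM => //.
    exact: (measurableT_comp (measurable_powR (-1)) (measurable_coord_rV i)).
  exists 1 => v ov; rewrite normr_prod; apply: prodr_ile1 => i.
  rewrite normr_ge0/= ger0_norm ?ge_min ?lexx// le_min ler01/=.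
  by rewrite divr_ge0// ltW.
have E (Q : probability 'rV[R]_d R) : \int[Q]_(v in orthant) box_ratio a v =
    \int[leb]_(x in box a) smu_density Q x.
  by rewrite /Rintegral smu_density_cdf.
rewrite /integral_cvg E; under eq_cvg do rewrite E.
exact: smu_mass_cvg (measurable_box a) hL.
Qed.

(** Expanding the product leaves a linear combination of functions box_ratio,
whose integrals are values of the distribution functions of the densities. *)
Lemma integral_cvg_prod_ratio (K : finType) (c s : 'I_d -> K -> R) :
  (forall i k, 0 <= s i k) ->
  let T v := \prod_(i < d) \sum_k c i k * Num.min 1 (s i k / v ord0 i) in
  regular T /\ integral_cvg T.
Proof.
move=> s0 T.
pose a (b : {ffun 'I_d -> K}) : 'rV[R]_d := \row_i s i (b i).
have -> : T = fun v => \sum_(b : {ffun 'I_d -> K})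
    (\prod_(i < d) c i (b i)) * box_ratio (a b) v.
  apply/funext => v; rewrite /T.
  rewrite (bigA_distr_bigA (fun i k => c i k * Num.min 1 (s i k / v ord0 i))).
  apply: eq_bigr => b _; rewrite big_split/=; congr (_ * _).
  by apply: eq_bigr => i _; rewrite mxE.
have h b : regular (box_ratio (a b)) /\ integral_cvg (box_ratio (a b)).
  by apply: integral_cvg_box_ratio => i; rewrite mxE.
split; last by apply: integral_cvg_sum => b; have [] := h b.
by apply: regular_sum => b; apply: regularZ; have [] := h b.
Qed.

End weak_consistency.

(** * Approximation from below by hat functions *)

Section lower_approximation.
Context {R : realType} {d : nat}.
Implicit Types (phi : 'rV[R]_d -> R) (u v : 'rV[R]_d).
Let mO := @measurable_orthant R d.

Definition mesh (m : nat) : R := m.+1%:R^-1.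

(** The number of nodes in each direction is the square of the inverse mesh, so
that the grid both refines and exhausts the orthant. *)
Definition near_node m (b : {ffun 'I_d -> 'I_(m.+1 ^ 2)}) : set 'rV[R]_d :=
  [set u | orthant u /\ forall i, `|u ord0 i - (b i).+1%:R * mesh m| < mesh m].

Definition bump m (b : {ffun 'I_d -> 'I_(m.+1 ^ 2)}) v : R :=
  \prod_(i < d) hat (b i) (mesh m) (v ord0 i).

(** Infima instead of values at the nodes keep the approximation below phi
everywhere, so that the mass that the mixing distributions may carry far away
can only help in the lower bound. *)
Definition lower_approx phi m v : R :=
  \sum_(b : {ffun 'I_d -> 'I_(m.+1 ^ 2)}) inf (phi @` near_node b) * bump b v.

Let mesh_gt0 m : 0 < mesh m. Proof. by rewrite invr_gt0. Qed.

Lemma near_node_neq0 m (b : {ffun 'I_d -> 'I_(m.+1 ^ 2)}) : near_node b !=set0.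
Proof.
exists (\row_i ((b i).+1%:R * mesh m)); split => i; rewrite mxE.
  by rewrite mulr_gt0.
by rewrite subrr normr0.
Qed.

Lemma bump_ge0 m (b : {ffun 'I_d -> 'I_(m.+1 ^ 2)}) v : orthant v -> 0 <= bump b v.
Proof. by move=> ov; apply: prodr_ge0 => i _; exact: hat_ge0. Qed.

Lemma bump_support m (b : {ffun 'I_d -> 'I_(m.+1 ^ 2)}) v : orthant v ->
  bump b v != 0 -> near_node b v.
Proof.
move=> ov /prodf_neq0 bv; split => // i.
by apply: hat_support => //; exact: bv.
Qed.

Lemma sum_bump m v : \sum_b @bump m b v =
  \prod_(i < d) ramp (m.+1 ^ 2) (mesh m) (v ord0 i).
Proof.
under [RHS]eq_bigr do rewrite -sum_hat.
by rewrite (bigA_distr_bigA (fun i (j : 'I_(m.+1 ^ 2)) => hat j (mesh m) (v ord0 i))).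
Qed.

Lemma ramp_ge0 N (h t : R) : 0 < h -> 0 < t -> 0 <= ramp N h t.
Proof. by move=> h0 t0; rewrite -sum_hat sumr_ge0// => j _; exact: hat_ge0. Qed.

Lemma sum_bump_le1 m v : orthant v -> \sum_b @bump m b v <= 1.
Proof.
move=> ov; rewrite sum_bump; apply: prodr_ile1 => i.
by rewrite ramp_ge0//= ramp_le1.
Qed.

Lemma sum_bump_eq1 m v : orthant v -> (forall i, v ord0 i <= m.+1%:R) ->
  \sum_b @bump m b v = 1.
Proof.
move=> ov vm; rewrite sum_bump big1// => i _; apply: ramp_eq1 => //.
by rewrite natrX expr2 -mulrA divff ?mulr1.
Qed.

Variables (phi : 'rV[R]_d -> R) (C : R).
Hypotheses (phi0 : forall v, orthant v -> 0 <= phi v <= C)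
  (cphi : {within orthant, continuous phi}).

Let lb m (b : {ffun 'I_d -> 'I_(m.+1 ^ 2)}) : lbound (phi @` near_node b) 0.
Proof. by move=> _ [u [ou _] <-]; have /andP[] := phi0 ou. Qed.

Let inf_ge0 m (b : {ffun 'I_d -> 'I_(m.+1 ^ 2)}) : 0 <= inf (phi @` near_node b).
Proof. by apply: lb_le_inf; [exact/image_nonempty/near_node_neq0|exact: lb]. Qed.

Lemma lower_approx_ge0 m v : orthant v -> 0 <= lower_approx phi m v.
Proof. by move=> ov; apply: sumr_ge0 => b _; rewrite mulr_ge0// bump_ge0. Qed.

Lemma lower_approx_le m v : orthant v -> lower_approx phi m v <= phi v.
Proof.
move=> ov; have /andP[p0 _] := phi0 ov.
apply: (@le_trans _ _ (\sum_b phi v * @bump m b v)); last first.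
  by rewrite -mulr_sumr ler_piMr// sum_bump_le1.
apply: ler_sum => b _; have [->|bv] := eqVneq (bump b v) 0; first by rewrite !mulr0.
apply: ler_wpM2r; first exact: bump_ge0.
by apply: ge_inf; [exists 0; exact: lb|exists v => //; exact: bump_support].
Qed.

(** At v only the nodes at distance less than the mesh contribute, and as soon
as the grid covers v the weights sum to 1. *)
Lemma lower_approx_cvg v : orthant v ->
  lower_approx phi m v @[m --> \oo] --> phi v.
Proof.
move=> ov; apply/cvgrPdist_le => e e0.
have /subspace_continuousP/(_ v ov)/cvgrPdist_le/(_ _ e0) := cphi.
rewrite /prop_near1 /= /within => /nbhs_ballP[r /= r0 rv].
have r2 : 0 < r / 2 by rewrite divr_gt0.
near=> m.
have mr : 2 * mesh m < r.
  rewrite mulrC -ltr_pdivlMr//.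
  have : `|0 - mesh m| < r / 2.
    by near: m; have /cvgrPdist_lt/(_ _ r2) := @cvg_harmonic R.
  by rewrite sub0r normrN gtr0_norm.
have vm i : v ord0 i <= m.+1%:R.
  move: i; near: m; apply: filter_forall => i.
  near=> m; apply: (@le_trans _ _ (Num.truncn (v ord0 i)).+1%:R).
    exact/ltW/truncnS_gt.
  by rewrite ler_nat ltnS; near: m; exists (Num.truncn (v ord0 i)).
have up := lower_approx_le m ov.
rewrite ger0_norm ?subr_ge0// lerBlDr addrC -lerBlDr.
rewrite -[leLHS]mulr1 -(sum_bump_eq1 ov vm) mulr_sumr; apply: ler_sum => b _.
have [->|bv] := eqVneq (bump b v) 0; first by rewrite !mulr0.
apply: ler_wpM2r; first exact: bump_ge0.
apply: lb_le_inf; first exact/image_nonempty/near_node_neq0.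
move=> _ [u [ou hu] <-].
have [_ hv] := bump_support ov bv.
have : `|phi v - phi u| <= e.
  apply: rv => //; split => // i j; rewrite (ord1 i) /ball/=.
  rewrite -(subrK ((b j).+1%:R * mesh m) (v _ _)) -addrA.
  apply: le_lt_trans (ler_normD _ _) _.
  rewrite (distrC _ (u _ _)); apply: lt_trans mr.
  by rewrite mulr2n mulrDl mul1r ltrD// hv.
by rewrite ler_norml => /andP[_]; lra.
Unshelve. all: by end_near. Qed.

Lemma within_continuous_measurable : measurable_fun orthant phi.
Proof.
apply: (measurability _ (RGenOpens.measurableE R)).
move=> _ [_ [a [b ->] <-]].
set U := `]a, b[%classic.
have oU : open U by exact: interval_open.
rewrite (_ : _ `&` _ = orthant `&`
    interior [set u | orthant u -> U (phi u)]); last first.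
  apply/seteqP; split => v /= [ov hv]; split => //; last first.
    by apply: (nbhs_singleton hv).
  have UP : nbhs (phi v) U by apply: open_nbhs_nbhs; split.
  have /subspace_continuousP/(_ v ov) := cphi.
  by move=> /(_ U UP).
by apply: measurableI => //; apply: open_measurable_rV; exact: open_interior.
Qed.

Lemma lower_approx_integral_cvg (Q : probability 'rV[R]_d R) :
  (forall m, regular (lower_approx phi m)) ->
  \int[Q]_(v in orthant) lower_approx phi m v @[m --> \oo] -->
  \int[Q]_(v in orthant) phi v.
Proof.
move=> rA.
have [] := @dominated_convergence _ _ _ Q orthant mO
  (fun m v => (lower_approx phi m v)%:E) (EFin \o phi) (cst C%:E).
- by move=> m; apply/measurable_EFinP; case: (rA m).
- by apply/measurable_EFinP; exact: within_continuous_measurable.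
- apply: aeW => v ov; apply/fine_cvgP; split; first exact: nearW.
  exact: lower_approx_cvg.
- by apply: (regular_integrable Q (regular_cst C)).
- apply: aeW => v m ov; rewrite lee_fin ger0_norm ?lower_approx_ge0//.
  by apply: (le_trans (lower_approx_le m ov)); have /andP[] := phi0 ov.
move=> iphi _.
by rewrite -(fineK (integrable_fin_num mO iphi)) => /fine_cvgP[].
Qed.

End lower_approximation.

(** * Weak convergence of the mixing distributions *)

Section weak_convergence.
Context {R : realType} {d : nat}.
Variables (G : nat -> probability 'rV[R]_d R) (G0 : probability 'rV[R]_d R).
Hypotheses (mG : forall n, (0 < n)%N -> mixing (G n)) (mG0 : mixing G0).
Hypothesis hL : L1_distance (smu_density (G n)) (smu_density G0) @[n --> \oo] --> 0%E.
Implicit Types (phi : 'rV[R]_d -> R).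
Let mO := @measurable_orthant R d.

Lemma regular_bump m (b : {ffun 'I_d -> 'I_(m.+1 ^ 2)}) :
  regular (@bump R d m b) /\ integral_cvg G G0 (bump b).
Proof.
pose c i (k : 'I_3) : R := nth 0
  [:: (b i).+1%:R * 2; - (b i).+1%:R; - (b i).+1%:R] k.
pose s i (k : 'I_3) : R := nth 0
  [:: (b i).+1%:R * mesh m; (b i)%:R * mesh m; (b i).+2%:R * mesh m] k.
have s0 i k : 0 <= s i k.
  have m0 : 0 <= mesh m :> R by rewrite invr_ge0.
  by rewrite /s; case: k => -[|[|[|//]]] /= _; rewrite mulr_ge0.
have := integral_cvg_prod_ratio mG mG0 hL c s0.
rewrite (_ : (fun v => _) = bump b)//.
apply/funext => v; apply: eq_bigr => i _.
by rewrite !big_ord_recl big_ord0/= /c /s /hat/=; ring.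
Qed.

(** The lower half of weak convergence: approximate phi from below under G0,
then let n grow for the fixed approximation. *)
Lemma liminf_integral phi C : (forall v, orthant v -> 0 <= phi v <= C) ->
  {within orthant, continuous phi} -> forall e, 0 < e ->
  \forall n \near \oo,
    \int[G0]_(v in orthant) phi v - e <= \int[G n]_(v in orthant) phi v.
Proof.
move=> phi0 cphi e e0; have e2 : 0 < e / 2 by rewrite divr_gt0.
have rb m b := (@regular_bump m b).1.
have rA m : regular (lower_approx phi m).
  by apply: regular_sum => b; exact/regularZ/rb.
have /cvgrPdist_le/(_ _ e2) [m _ /(_ m (leqnn _)) /= hm] :=
  lower_approx_integral_cvg phi0 cphi (Q := G0) rA.
have : integral_cvg G G0 (lower_approx phi m).
  by apply: integral_cvg_sum => b; [exact: rb|exact: (@regular_bump m b).2].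
move=> /cvgrPdist_le/(_ _ e2); apply: filterS => n hn.
have rphi : regular phi.
  split; first exact: within_continuous_measurable.
  by exists C => v ov; have /andP[p0 pC] := phi0 v ov; rewrite ger0_norm.
have : \int[G n]_(v in orthant) lower_approx phi m v <= \int[G n]_(v in orthant) phi v.
  apply: le_Rintegral => //; [exact: regular_integrable|exact: regular_integrable|].
  by move=> v ov; exact: (lower_approx_le phi0).
move: hm hn; rewrite !ler_norml => /andP[_ h1] /andP[_ h2]; lra.
Qed.

(** The lower bound is applied to C + phi and to C - phi, which are nonnegative
when C bounds phi. *)
Lemma L1_weak_cvg : weak_cvg G G0.
Proof.
move=> phi cphi [M [_ hM]]; pose C := M + 1.
have hC v : orthant v -> `|phi v| <= C.
  by move=> ov; apply: (hM C) => //; rewrite ltrDl.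
have mphi := within_continuous_measurable cphi.
have rphi : regular phi by split; [exact: mphi|exists C].
have shift (k : R) (Q : probability 'rV[R]_d R) : mixing Q ->
    \int[Q]_(v in orthant) (k * phi v + C) = k * \int[Q]_(v in orthant) phi v + C.
  move=> mQ; rewrite RintegralD//; last 2 first.
  - by apply: regular_integrable; exact: regularZ.
  - by apply: regular_integrable; exact: regular_cst.
  rewrite RintegralZl//; last exact: regular_integrable.
  by rewrite Rintegral_cst// [X in fine X](mQ : Q orthant = 1%E) mulr1.
have low (k : R) : `|k| = 1 -> forall e, 0 < e -> \forall n \near \oo,
    k * \int[G0]_(v in orthant) phi v - e <= k * \int[G n]_(v in orthant) phi v.
  move=> k1 e e0.
  have bnd v : orthant v -> 0 <= k * phi v + C <= C + C.
    move=> /hC; rewrite -[`|phi v|]mul1r -k1 -normrM ler_norml => /andP[h1 h2].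
    by apply/andP; split; lra.
  have cont : {within orthant, continuous (fun v => k * phi v + C)}.
    move=> v; apply: cvgD; last exact: cvg_cst.
    by apply: cvgM; [exact: cvg_cst|exact: cphi].
  have := liminf_integral bnd cont e0; have := nbhs_infty_gt 0.
  apply: filterS2 => n n0; rewrite !shift//; [lra|exact: mG].
apply/cvgrPdist_le => e e0.
have h1 := low 1 (normr1 _) _ e0.
have h2 := low (- 1) (normrN1 _) _ e0.
apply: filterS2 h1 h2 => n h1 h2.
by rewrite ler_norml; apply/andP; split; lra.
Qed.

End weak_convergence.

(** * Consistency of the maximum likelihood estimator *)

Theorem proposition3p5 (R : realType) (d : nat) (d_gt0 : (0 < d)%N)
    (G0 : probability 'rV[R]_d R) (P : probability (sample_space R d) R)
    (Ghat : nat -> sample_space R d -> probability 'rV[R]_d R)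
    (f0 := smu_density G0)
    (fhat := fun n w => smu_density (Ghat n w)) :
  mixing G0 ->
  iid_law P f0 ->
  (forall n : nat, (0 < n)%N ->
    {ae P, forall w, mixing (Ghat n w) /\ is_MLE n w (fhat n w)}) ->
  [/\ {ae P, forall w, weak_cvg (Ghat ^~ w) G0},
      {ae lebesgue_rV d, forall x, orthant x ->
        {ae P, forall w, fhat n w x @[n --> \oo] --> f0 x}},
      (forall x, orthant x -> {for x, continuous f0} ->
        {ae P, forall w, `|fhat n w x - f0 x| @[n --> \oo] --> 0}) &
      {ae P, forall w,
        L1_distance (fhat n w) f0 @[n --> \oo] --> 0%E /\
        hellinger (fhat n w) f0 @[n --> \oo] --> 0%E}].
Proof.
move=> mG0 iidP hMLE.
have hG : {ae P, forall w, forall n, (0 < n)%N ->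
    mixing (Ghat n w) /\ is_MLE n w (fhat n w)}.
  by apply: ae_foralln => n; case: n => [|n]; [exact: aeW|
    have := hMLE n.+1 isT; apply: filterS => w hw _].
have good : {ae P, forall w, (forall n, (0 < n)%N -> mixing (Ghat n w)) /\
    L1_distance (fhat n w) f0 @[n --> \oo] --> 0%E}.
  have := ae_typical iidP; apply: filterS2 hG => w hw tw.
  split; first by move=> n /hw[].
  exact: (typical_L1_cvg mG0 iidP tw hw).
have ptwise x : orthant x -> shift_accessible G0 x ->
    {ae P, forall w, fhat n w x @[n --> \oo] --> f0 x}.
  move=> ox ax; apply: filterS good => w [mG hL].
  exact: smu_density_pointwise_cvg.
split.
- by apply: filterS good => w [mG hL]; exact: L1_weak_cvg.
- have := ae_no_atom G0; apply: filterS => x hx ox; apply: ptwise => //.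
  exact: no_atom_shift_accessible.
- move=> x ox cx; have ax := continuous_shift_accessible ox cx.
  apply: filterS (ptwise x ox ax) => w h.
  rewrite -(normr0 R) -(subrr (f0 x)).
  by apply: cvg_norm; apply: cvgB => //; exact: cvg_cst.
- by apply: filterS good => w [mG hL]; split => //; exact: hellinger_cvg.
Qed.
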